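(* Let $f,g\in{\rm elh}(\mathbb{C})$. Then $A(f\circ g)=A(f)\cup f(A(g))$.
   Context: ${\rm elh}(\mathbb{C})$ denotes the set of entire functions $f:\mathbb{C}\to\mathbb{C}$ such that $f'(z)\neq 0$ for all $z\in\mathbb{C}$ and $f'(0)=1$. For an entire function $f$, its asymptotic variety is $A(f)=\{\alpha\in\mathbb{C}\,:\,\exists\,\gamma:[0,\infty)\to\mathbb{C}$ continuous with $\lim_{t\to\infty}|\gamma(t)|=\infty$ and $\lim_{t\to\infty}f(\gamma(t))=\alpha\}$. *)

(* Defs.v *)
From Stdlib Require Import Reals.
From Coquelicot Require Import Coquelicot.
Open Scope R_scope.

Definition has_cderiv (f : C -> C) (z l : C) : Prop :=
  @is_derive C_AbsRing C_NormedModule f z l.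

(* elh(C): entire, locally univalent (f' never 0), normalized f'(0) = 1 *)
Definition elh (f : C -> C) : Prop :=
  (forall z : C, exists l : C, has_cderiv f z l /\ l <> 0%C)
  /\ has_cderiv f 0%C 1%C.

Definition cont_on_halfline (gamma : R -> C) : Prop :=
  forall t : R, 0 <= t ->
    filterlim gamma (within (fun s : R => 0 <= s) (locally t)) (locally (gamma t)).

Definition asymptotic_variety (f : C -> C) : C -> Prop :=
  fun alpha => exists gamma : R -> C,
    cont_on_halfline gamma
    /\ filterlim (fun t => Cmod (gamma t)) (Rbar_locally p_infty) (Rbar_locally p_infty)
    /\ filterlim (fun t => f (gamma t)) (Rbar_locally p_infty) (locally alpha).

(* Main.v *)
Require Import Defs.
From Stdlib Require Import Reals ZArith Lra Classical ClassicalEpsilon.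
From Coquelicot Require Import Coquelicot.

(** Suppose [f (g z)] tends to [alpha] along a curve going to infinity.  Then [g] along that curve
    either escapes to infinity or clusters at some [zeta] with [f zeta = alpha]; since
    [f' zeta <> 0], in the latter case it converges to [zeta].  For the converse, the difficulty is
    that a curve [gamma] along which [f] tends to [alpha] need not lift through [g].  It suffices
    to find a curve [delta] with [g o delta] so close to [gamma] that [f] barely sees the
    difference.  Such a [delta] is built by moving inside components of preimages of small discs
    under [g]: the image of a component of [|g - b| < R] comes arbitrarily close to [b], since
    otherwise [1 / (g - b)] would be bounded there and violate the Phragmen-Lindelof principle.
    That principle rests on the mean value property, obtained from Goursat's theorem. *)

(** * Continuity and complex differentiability *)

(** A lift of [gamma] through [g] can run off to infinity at a finite time, namely when [gamma]
    meets an asymptotic value of [g]; that [g'] never vanishes does not prevent this. The components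
    in question may be unbounded, so the plain maximum principle does not apply to [1 / (g - b)]; a
    version is needed that asks only for boundedness inside the domain. That version needs a disc
    disjoint from the domain, and Liouville's theorem supplies it, since a nonconstant entire [g]
    leaves [|g - b| <= R] somewhere. That [delta] tends to infinity then costs nothing: [g o delta]
    stays within distance 1 of points of [gamma] at ever later times, whereas [g] is bounded near
    any finite cluster point of [delta]. *)

Lemma ball_of_Cmod (x y : C) (e : R) : Cmod (y - x) < e -> ball (M := C_UniformSpace) x e y.
Proof. exact (C_NormedModule_mixin_compat1 x y e). Qed.

(** Balls of [C_UniformSpace] are squares, because its structure is that of a product; the factor
    [sqrt 2] for the half-diagonal is rounded up to 2. *)
Lemma Cmod_of_ball (x y : C) (e : posreal) :
  ball (M := C_UniformSpace) x e y -> Cmod (y - x) < 2 * e.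
Proof.
  intros H.
  apply Rlt_le_trans with (sqrt 2 * e).
  - exact (C_NormedModule_mixin_compat2 x y e H).
  - apply Rmult_le_compat_r; [left; apply cond_pos|].
    rewrite <- (sqrt_square 2) at 2 by lra. apply sqrt_le_1; lra.
Qed.

Lemma locally_Cmod (z : C) (P : C -> Prop) :
  locally (T := C_UniformSpace) z P <->
  exists d, 0 < d /\ forall w, Cmod (w - z) < d -> P w.
Proof.
  split.
  - intros [e He]. exists e. split; [apply cond_pos|].
    intros w Hw. apply He, ball_of_Cmod, Hw.
  - intros [d [Hd H]].
    exists (mkposreal (d / 2) ltac:(lra)). intros w Hw.
    apply H. apply Cmod_of_ball in Hw. simpl in Hw. lra.
Qed.

Lemma filterlim_C {T : Type} (F : (T -> Prop) -> Prop) {FF : Filter F} (f : T -> C) (l : C) :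
  filterlim f F (locally (T := C_UniformSpace) l) <->
  forall e, 0 < e -> F (fun x => Cmod (f x - l) < e).
Proof.
  split.
  - intros H e He. apply (H (fun w => Cmod (w - l) < e)).
    apply locally_Cmod. exists e. split; auto.
  - intros H P HP. apply locally_Cmod in HP. destruct HP as [d [Hd HP]].
    unfold filtermap. apply (filter_imp (fun x => Cmod (f x - l) < d)); auto.
Qed.

Notation ccont f z := (@continuous C_UniformSpace C_UniformSpace f z).

Lemma ccont_eps (f : C -> C) (z : C) :
  ccont f z <->
  forall e, 0 < e -> exists d, 0 < d /\ forall w, Cmod (w - z) < d -> Cmod (f w - f z) < e.
Proof.
  unfold continuous. rewrite filterlim_C by apply locally_filter.
  split; intros H e He; specialize (H e He); apply locally_Cmod in H; exact H.
Qed.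

Section continuity.
Context {U : UniformSpace}.
Implicit Types (f g : U -> C) (x : U).

Lemma continuous_C_pair (a b : U -> R) x :
  continuous a x -> continuous b x ->
  @continuous U C_UniformSpace (fun t => (a t, b t)) x.
Proof.
  intros Ha Hb. apply filterlim_C; [apply locally_filter|]. intros e He.
  assert (He2 : 0 < e / 2) by lra.
  assert (H := filter_and _ _ (proj1 (filterlim_locally a (a x)) Ha (mkposreal _ He2))
                          (proj1 (filterlim_locally b (b x)) Hb (mkposreal _ He2))).
  revert H. apply filter_imp. intros t [H1 H2].
  apply Rle_lt_trans with (sqrt 2 * Rmax (Rabs (a t - a x)) (Rabs (b t - b x))).
  - apply (Cmod_2Rmax ((a t, b t) - (a x, b x))%C).
  - change (Rabs (a t - a x) < e / 2) in H1. change (Rabs (b t - b x) < e / 2) in H2.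
    assert (0 <= sqrt 2 <= 2).
    { split; [apply sqrt_pos|]. rewrite <- (sqrt_square 2) at 2 by lra. apply sqrt_le_1; lra. }
    assert (Rmax (Rabs (a t - a x)) (Rabs (b t - b x)) < e / 2) by (apply Rmax_lub_lt; assumption).
    assert (0 <= Rmax (Rabs (a t - a x)) (Rabs (b t - b x))).
    { apply Rle_trans with (1 := Rabs_pos (a t - a x)), Rmax_l. }
    nra.
Qed.

Lemma continuous_Re f x : @continuous U C_UniformSpace f x -> continuous (fun t => Re (f t)) x.
Proof.
  intros H. apply (continuous_comp f (fst : C_UniformSpace -> R_UniformSpace)); [exact H|].
  destruct (f x). apply (continuous_fst (U := R_UniformSpace) (V := R_UniformSpace)).
Qed.

Lemma continuous_Im f x : @continuous U C_UniformSpace f x -> continuous (fun t => Im (f t)) x.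
Proof.
  intros H. apply (continuous_comp f (snd : C_UniformSpace -> R_UniformSpace)); [exact H|].
  destruct (f x). apply (continuous_snd (U := R_UniformSpace) (V := R_UniformSpace)).
Qed.

Lemma continuous_Cplus f g x :
  @continuous U C_UniformSpace f x -> @continuous U C_UniformSpace g x ->
  @continuous U C_UniformSpace (fun t => (f t + g t)%C) x.
Proof. exact (continuous_plus (V := C_R_NormedModule) f g x). Qed.

Lemma continuous_Cminus f g x :
  @continuous U C_UniformSpace f x -> @continuous U C_UniformSpace g x ->
  @continuous U C_UniformSpace (fun t => (f t - g t)%C) x.
Proof. exact (continuous_minus (V := C_R_NormedModule) f g x). Qed.

Lemma continuous_Cmult f g x :
  @continuous U C_UniformSpace f x -> @continuous U C_UniformSpace g x ->
  @continuous U C_UniformSpace (fun t => (f t * g t)%C) x.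
Proof.
  intros Hf Hg.
  assert (Hf1 := continuous_Re _ _ Hf). assert (Hf2 := continuous_Im _ _ Hf).
  assert (Hg1 := continuous_Re _ _ Hg). assert (Hg2 := continuous_Im _ _ Hg).
  apply continuous_C_pair.
  - apply (continuous_minus (V := R_NormedModule)); apply (continuous_mult (K := R_AbsRing)); assumption.
  - apply (continuous_plus (V := R_NormedModule)); apply (continuous_mult (K := R_AbsRing)); assumption.
Qed.

Lemma continuous_Cinv f x :
  @continuous U C_UniformSpace f x -> f x <> 0%C ->
  @continuous U C_UniformSpace (fun t => (/ f t)%C) x.
Proof.
  intros Hf Hx.
  assert (Hf1 := continuous_Re _ _ Hf). assert (Hf2 := continuous_Im _ _ Hf).
  assert (Hq : continuous (fun t => / (Re (f t) ^ 2 + Im (f t) ^ 2)) x).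
  { apply (continuous_comp (fun t => Re (f t) ^ 2 + Im (f t) ^ 2) Rinv);
      [|apply continuous_Rinv].
    - apply (continuous_plus (V := R_NormedModule)).
      + apply (continuous_mult (K := R_AbsRing)); [assumption|].
        apply (continuous_mult (K := R_AbsRing)); [assumption|apply continuous_const].
      + apply (continuous_mult (K := R_AbsRing)); [assumption|].
        apply (continuous_mult (K := R_AbsRing)); [assumption|apply continuous_const].
    - rewrite <- Cmod2_alt. apply pow_nonzero. intros H. apply Hx, Cmod_eq_0, H. }
  apply continuous_C_pair.
  - apply (continuous_mult (K := R_AbsRing)); assumption.
  - apply (continuous_mult (K := R_AbsRing)); [|assumption].
    apply (continuous_opp (V := R_NormedModule)); assumption.
Qed.

Lemma continuous_Cpow f n x :
  @continuous U C_UniformSpace f x -> @continuous U C_UniformSpace (fun t => (f t ^ n)%C) x.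
Proof.
  intros Hf. induction n as [|n IH]; simpl; [apply continuous_const|].
  apply continuous_Cmult; assumption.
Qed.

Lemma continuous_Cmod f x :
  @continuous U C_UniformSpace f x -> continuous (fun t => Cmod (f t)) x.
Proof.
  intros H. apply (continuous_comp f (Cmod : C_UniformSpace -> R_UniformSpace)); [exact H|].
  exact (filterlim_norm (V := C_NormedModule) (f x)).
Qed.

End continuity.

(** Caratheodory's form of differentiability: [phi] is the difference quotient, with the derivative
    as its value at [z]. The product and chain rules become ring identities together with continuity
    of [phi]. *)
Definition cdiff (f : C -> C) (z : C) : Prop :=
  exists phi : C -> C, ccont phi z /\ forall w, f w = (f z + phi w * (w - z))%C.

Lemma continuous_Cid (z : C) : ccont (fun w => w) z.
Proof. apply continuous_id. Qed.

Lemma cdiff_ccont f z : cdiff f z -> ccont f z.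
Proof.
  intros [phi [Hphi H]].
  apply continuous_ext with (fun w => f z + phi w * (w - z))%C; [intros; symmetry; apply H|].
  apply continuous_Cplus; [apply continuous_const|].
  apply continuous_Cmult; [assumption|].
  apply continuous_Cminus; [apply continuous_id|apply continuous_const].
Qed.

Lemma cdiff_const c z : cdiff (fun _ => c) z.
Proof. exists (fun _ => 0%C). split; [apply continuous_const|]. intros; ring. Qed.

Lemma cdiff_id z : cdiff (fun w => w) z.
Proof. exists (fun _ => 1%C). split; [apply continuous_const|]. intros; ring. Qed.

Lemma cdiff_plus f g z : cdiff f z -> cdiff g z -> cdiff (fun w => f w + g w)%C z.
Proof.
  intros [p [Hp Hf]] [q [Hq Hg]]. exists (fun w => p w + q w)%C.
  split; [apply continuous_Cplus; assumption|]. intros w. rewrite (Hf w), (Hg w). ring.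
Qed.

Lemma cdiff_mult f g z : cdiff f z -> cdiff g z -> cdiff (fun w => f w * g w)%C z.
Proof.
  intros [p [Hp Hf]] Dg. assert (Cg := cdiff_ccont _ _ Dg). destruct Dg as [q [Hq Hg]].
  exists (fun w => p w * g w + f z * q w)%C. split.
  - apply continuous_Cplus; apply continuous_Cmult; try assumption. apply continuous_const.
  - intros w. rewrite (Hf w). rewrite (Hg w). ring.
Qed.

Lemma cdiff_minus f g z : cdiff f z -> cdiff g z -> cdiff (fun w => f w - g w)%C z.
Proof.
  intros [p [Hp Hf]] [q [Hq Hg]]. exists (fun w => p w - q w)%C.
  split; [apply continuous_Cminus; assumption|]. intros w. rewrite (Hf w), (Hg w). ring.
Qed.

Lemma cdiff_pow f n z : cdiff f z -> cdiff (fun w => f w ^ n)%C z.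
Proof.
  intros Hf. induction n as [|n IH]; simpl; [apply cdiff_const|].
  apply (cdiff_mult f (fun w => f w ^ n)%C); assumption.
Qed.

(* The Caratheodory quotient only has the right form where [f w <> 0]; elsewhere
   [Cinv] returns 0 and the quotient is corrected by hand. *)
Lemma cdiff_inv f z : cdiff f z -> f z <> 0%C -> cdiff (fun w => / f w)%C z.
Proof.
  intros Df Hz. assert (Cf := cdiff_ccont _ _ Df). destruct Df as [p [Hp Hf]].
  exists (fun w => if Ceq_dec (f w) 0 then (/ f w - / f z) / (w - z)
                   else - p w * / f w * / f z)%C.
  split.
  - apply continuous_ext_loc with (fun w => - p w * / f w * / f z)%C.
    + assert (0 < Cmod (f z)) by (apply Cmod_gt_0; assumption).
      destruct (proj1 (ccont_eps _ _) Cf (Cmod (f z)) H) as [d [Hd Hd2]].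
      apply locally_Cmod. exists d. split; [assumption|]. intros w Hw.
      destruct (Ceq_dec (f w) 0) as [E|E]; [|reflexivity].
      specialize (Hd2 w Hw). rewrite E in Hd2.
      replace (0 - f z)%C with (- f z)%C in Hd2 by ring. rewrite Cmod_opp in Hd2. lra.
    + apply continuous_Cmult; [|apply continuous_const].
      apply continuous_Cmult; [|apply continuous_Cinv; assumption].
      apply continuous_ext with (fun w => 0 - p w)%C; [intros w; change (0 - p w = - p w)%C; ring|].
      apply continuous_Cminus; [apply continuous_const|assumption].
  - intros w. destruct (Ceq_dec (f w) 0) as [E|E].
    + destruct (Ceq_dec w z) as [->|E2]; [contradiction|].
      generalize (/ f w)%C, (/ f z)%C. intros a b. field.
      intros H. apply E2. replace w with (w - z + z)%C by ring. rewrite H. ring.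
    + rewrite (Hf w) in E |- *. field. split; assumption.
Qed.

Lemma cdiff_comp f g z : cdiff g z -> cdiff f (g z) -> cdiff (fun w => f (g w)) z.
Proof.
  intros Dg [p [Hp Hf]]. assert (Cg := cdiff_ccont _ _ Dg). destruct Dg as [q [Hq Hg]].
  exists (fun w => p (g w) * q w)%C. split.
  - apply continuous_Cmult; [|assumption]. apply (continuous_comp g p); assumption.
  - intros w. rewrite (Hf (g w)). rewrite (Hg w) at 2. ring.
Qed.

Lemma has_cderiv_caratheodory f z l :
  has_cderiv f z l ->
  exists phi : C -> C, ccont phi z /\ phi z = l /\ forall w, f w = (f z + phi w * (w - z))%C.
Proof.
  intros [_ H]. specialize (H z (fun P HP => HP)).
  set (phi := fun w => if Ceq_dec w z then l else ((f w - f z) / (w - z))%C).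
  assert (Hz : phi z = l) by (unfold phi; destruct (Ceq_dec z z); congruence).
  assert (Hne : forall w, w <> z -> (w - z)%C <> 0%C).
  { intros w Hw E. apply Hw. replace w with (w - z + z)%C by ring. rewrite E. ring. }
  exists phi. split; [|split; [assumption|]].
  - apply ccont_eps. intros e He.
    specialize (H (mkposreal (e / 2) ltac:(lra))). simpl in H.
    (* The derivative lives in the topology of [C_AbsRing], continuity in that of the product;
       [locally_C] identifies their neighbourhoods. *)
    apply locally_C in H. apply locally_Cmod in H. destruct H as [d [Hd H]].
    exists d. split; [assumption|]. intros w Hw. rewrite Hz. unfold phi.
    destruct (Ceq_dec w z) as [E|E].
    + replace (l - l)%C with (RtoC 0) by ring. rewrite Cmod_0. assumption.
    + specialize (H w Hw). change (Cmod (f w - f z - (w - z) * l) <= e / 2 * Cmod (w - z)) in H.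
      replace (f w - f z - (w - z) * l)%C with (((f w - f z) / (w - z) - l) * (w - z))%C in H
        by (field; auto).
      rewrite Cmod_mult in H.
      assert (0 < Cmod (w - z)) by (apply Cmod_gt_0; auto).
      apply Rmult_le_reg_r in H; lra.
  - intros w. unfold phi. destruct (Ceq_dec w z) as [->|E]; [ring|field; auto].
Qed.

(** * Goursat's theorem *)

(** The invariant [Q] travels with the point, so a successor need exist only where [Q] holds. This
    produces both the nested rectangles and the chain of points that accompanies [gamma]. *)
Lemma dependent_choice_seq {T : Type} (Q : nat -> T -> Prop) (E : nat -> T -> T -> Prop) (x0 : T) :
  Q 0%nat x0 ->
  (forall n x, Q n x -> exists y, Q (S n) y /\ E n x y) ->
  exists s : nat -> T, s 0%nat = x0 /\ forall n, Q n (s n) /\ E n (s n) (s (S n)).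
Proof.
  intros H0 Hs.
  set (nxt := fun n (x : sig (Q n)) =>
    constructive_indefinite_description _ (Hs n (proj1_sig x) (proj2_sig x))).
  set (st := nat_rect (fun n => sig (Q n)) (exist _ x0 H0)
    (fun n x => exist (Q (S n)) (proj1_sig (nxt n x)) (proj1 (proj2_sig (nxt n x))))).
  exists (fun n => proj1_sig (st n)). split; [reflexivity|].
  intros n. split; [apply proj2_sig|]. exact (proj2 (proj2_sig (nxt n (st n)))).
Qed.

Lemma nested_intervals (a b : nat -> R) :
  (forall n, a n <= a (S n)) -> (forall n, b (S n) <= b n) -> (forall n, a n <= b n) ->
  exists u, forall n, a n <= u <= b n.
Proof.
  intros Ha Hb Hab.
  assert (Ha' : forall n k, a n <= a (k + n)%nat).
  { intros n k. induction k as [|k IH]; simpl; [lra|]. specialize (Ha (k + n)%nat). lra. }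
  assert (Hb' : forall n k, b (k + n)%nat <= b n).
  { intros n k. induction k as [|k IH]; simpl; [lra|]. specialize (Hb (k + n)%nat). lra. }
  assert (H : forall n m, a n <= b m).
  { intros n m. specialize (Ha' n m). specialize (Hb' m n). specialize (Hab (m + n)%nat).
    rewrite (Nat.add_comm n m) in Hb'. lra. }
  destruct (completeness (fun x => exists n, x = a n)) as [u [Hu1 Hu2]].
  - exists (b 0%nat). intros x [n ->]. apply H.
  - exists (a 0%nat), 0%nat. reflexivity.
  - exists u. intros n. split.
    + apply Hu1. exists n. reflexivity.
    + apply Hu2. intros x [m ->]. apply H.
Qed.

(** Kept abstract in [P] because it serves twice: with a lower bound on a boundary integral it
    drives Goursat's theorem, with nonempty intersection it is Bolzano-Weierstrass in the plane. *)
Lemma quadrisection (P : R -> R -> R -> R -> Prop) (a b c d : R) :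
  a <= b -> c <= d -> P a b c d ->
  (forall a b c d, P a b c d ->
     P a ((a + b) / 2) c ((c + d) / 2) \/ P ((a + b) / 2) b c ((c + d) / 2) \/
     P a ((a + b) / 2) ((c + d) / 2) d \/ P ((a + b) / 2) b ((c + d) / 2) d) ->
  exists u v, forall n, exists a' b' c' d',
    P a' b' c' d' /\ a <= a' <= u /\ u <= b' <= b /\ c <= c' <= v /\ v <= d' <= d /\
    b' - a' = (b - a) / 2 ^ n /\ d' - c' = (d - c) / 2 ^ n.
Proof.
  intros Hab Hcd HP Hstep.
  destruct (dependent_choice_seq
    (fun n (q : (R * R) * (R * R)) => let '((a', b'), (c', d')) := q in
       P a' b' c' d' /\ a <= a' <= b' /\ b' <= b /\ c <= c' <= d' /\ d' <= d /\
       b' - a' = (b - a) / 2 ^ n /\ d' - c' = (d - c) / 2 ^ n)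
    (fun n q r => fst (fst q) <= fst (fst r) /\ snd (fst r) <= snd (fst q) /\
       fst (snd q) <= fst (snd r) /\ snd (snd r) <= snd (snd q)) ((a, b), (c, d)))
    as [s [_ Hs]].
  - simpl. repeat split; try assumption; try lra.
  - intros n [[a' b'] [c' d']] (H & Ha & Hb & Hc & Hd & H1 & H2).
    assert (E1 : (b - a) / 2 ^ S n = (b' - a') / 2).
    { rewrite H1. simpl. field. apply pow_nonzero; lra. }
    assert (E2 : (d - c) / 2 ^ S n = (d' - c') / 2).
    { rewrite H2. simpl. field. apply pow_nonzero; lra. }
    rewrite E1, E2.
    destruct (Hstep _ _ _ _ H) as [K|[K|[K|K]]].
    + exists ((a', (a' + b') / 2), (c', (c' + d') / 2)). simpl. repeat split; try assumption; lra.
    + exists (((a' + b') / 2, b'), (c', (c' + d') / 2)). simpl. repeat split; try assumption; lra.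
    + exists ((a', (a' + b') / 2), ((c' + d') / 2, d')). simpl. repeat split; try assumption; lra.
    + exists (((a' + b') / 2, b'), ((c' + d') / 2, d')). simpl. repeat split; try assumption; lra.
  - assert (HQ : forall n, P (fst (fst (s n))) (snd (fst (s n))) (fst (snd (s n))) (snd (snd (s n))) /\
       a <= fst (fst (s n)) <= snd (fst (s n)) /\ snd (fst (s n)) <= b /\
       c <= fst (snd (s n)) <= snd (snd (s n)) /\ snd (snd (s n)) <= d /\
       snd (fst (s n)) - fst (fst (s n)) = (b - a) / 2 ^ n /\
       snd (snd (s n)) - fst (snd (s n)) = (d - c) / 2 ^ n).
    { intros n. destruct (Hs n) as [H _]. destruct (s n) as [[a' b'] [c' d']]. exact H. }
    destruct (nested_intervals (fun n => fst (fst (s n))) (fun n => snd (fst (s n)))) as [u Hu];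
      try (intros n; apply (Hs n)); [intros n; apply (HQ n)|].
    destruct (nested_intervals (fun n => fst (snd (s n))) (fun n => snd (snd (s n)))) as [v Hv];
      try (intros n; apply (Hs n)); [intros n; apply (HQ n)|].
    exists u, v. intros n.
    exists (fst (fst (s n))), (snd (fst (s n))), (fst (snd (s n))), (snd (snd (s n))).
    specialize (HQ n). specialize (Hu n). specialize (Hv n). simpl in Hu, Hv.
    repeat split; try apply HQ; lra.
Qed.

Lemma half_pow_small (x e : R) : 0 < e -> exists n, x / 2 ^ n < e.
Proof.
  intros He. destruct (pow_lt_1_zero (/ 2) ltac:(rewrite Rabs_pos_eq; lra) (e / (Rabs x + 1)))
    as [n Hn].
  - apply Rdiv_lt_0_compat; [assumption|]. generalize (Rabs_pos x). lra.
  - exists n. specialize (Hn n (le_n n)).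
    assert (H0 : 0 < (/ 2) ^ n) by (apply pow_lt; lra).
    rewrite Rabs_pos_eq in Hn by lra. unfold Rdiv. rewrite <- pow_inv.
    assert (Hx := Rabs_pos x). assert (Hx' := Rle_abs x).
    apply (Rmult_lt_compat_l (Rabs x + 1)) in Hn; [|lra].
    replace ((Rabs x + 1) * (e / (Rabs x + 1))) with e in Hn by (field; lra).
    nra.
Qed.

Lemma Cmod_le_abs (x y : R) : Cmod (x, y) <= Rabs x + Rabs y.
Proof.
  replace (x, y) with (RtoC x + RtoC y * Ci)%C
    by (unfold Cplus, Cmult, RtoC, Ci; simpl; f_equal; ring).
  eapply Rle_trans; [apply Cmod_triangle|].
  rewrite Cmod_mult, Cmod_Ci, !Cmod_R. lra.
Qed.

(* The family [Q] should be read as a filter base of bounded sets indexed by [e -> 0]. *)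
Lemma bounded_cluster_point (Q : R -> C -> Prop) (L : R) :
  (forall e e' z, e <= e' -> Q e z -> Q e' z) ->
  (forall e, 0 < e -> exists z, Q e z /\ Cmod z <= L) ->
  exists zeta, forall e, 0 < e -> exists z, Q e z /\ Cmod (z - zeta) < e.
Proof.
  intros Hmono HL.
  set (P := fun a b c d => forall e, 0 < e -> exists x y, Q e (x, y) /\ a <= x <= b /\ c <= y <= d).
  assert (L0 : 0 <= L).
  { destruct (HL 1 Rlt_0_1) as [z [_ Hz]]. generalize (Cmod_ge_0 z). lra. }
  destruct (quadrisection P (- L) L (- L) L) as (u & v & Huv); try lra.
  - intros e He. destruct (HL e He) as [[x y] [Hq Hz]]. exists x, y. split; [assumption|].
    assert (H := Rmax_Cmod (x, y)). simpl in H.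
    assert (H1 := Rmax_l (Rabs x) (Rabs y)). assert (H2 := Rmax_r (Rabs x) (Rabs y)).
    split; apply Rabs_le_between; lra.
  - intros a b c d H. apply NNPP. intros K.
    (* Each quarter that violates [P] has a threshold at which [Q] misses it; by [Hmono] the least
       of the four thresholds works for all quarters, hence for the whole rectangle. *)
    assert (K' : exists e, 0 < e /\ forall x y, Q e (x, y) -> a <= x <= b -> c <= y <= d -> False).
    { assert (N : forall a b c d, ~ P a b c d ->
        exists e, 0 < e /\ forall x y, Q e (x, y) -> a <= x <= b -> c <= y <= d -> False).
      { clear. intros a b c d H. apply NNPP. intros K. apply H. intros e He. apply NNPP. intros K2.
        apply K. exists e. split; [assumption|]. intros x y H1 H2 H3. apply K2. exists x, y. tauto. }
      destruct (N a ((a + b) / 2) c ((c + d) / 2)) as [e1 [E1 F1]]; [tauto|].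
      destruct (N ((a + b) / 2) b c ((c + d) / 2)) as [e2 [E2 F2]]; [tauto|].
      destruct (N a ((a + b) / 2) ((c + d) / 2) d) as [e3 [E3 F3]]; [tauto|].
      destruct (N ((a + b) / 2) b ((c + d) / 2) d) as [e4 [E4 F4]]; [tauto|].
      exists (Rmin (Rmin e1 e2) (Rmin e3 e4)).
      split; [repeat apply Rmin_glb_lt; assumption|].
      intros x y Hq Hx Hy.
      assert (M1 := Rmin_l (Rmin e1 e2) (Rmin e3 e4)).
      assert (M2 := Rmin_r (Rmin e1 e2) (Rmin e3 e4)).
      assert (M3 := Rmin_l e1 e2). assert (M4 := Rmin_r e1 e2).
      assert (M5 := Rmin_l e3 e4). assert (M6 := Rmin_r e3 e4).
      destruct (Rle_dec x ((a + b) / 2)), (Rle_dec y ((c + d) / 2));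
        [apply (F1 x y)|apply (F3 x y)|apply (F2 x y)|apply (F4 x y)];
        try lra; (apply Hmono with (2 := Hq); lra). }
    destruct K' as [e [He K']]. destruct (H e He) as (x & y & H1 & H2 & H3). exact (K' x y H1 H2 H3).
  - exists (u, v). intros e He.
    destruct (half_pow_small (L - - L) (e / 2)) as [n Hn]; [lra|].
    destruct (Huv n) as (a & b & c & d & HP & Ha & Hb & Hc & Hd & E1 & E2).
    destruct (HP e He) as (x & y & Hq & Hx & Hy). exists (x, y). split; [assumption|].
    apply Rle_lt_trans with (Rabs (x - u) + Rabs (y - v)); [apply (Cmod_le_abs (x - u) (y - v))|].
    assert (Rabs (x - u) <= b - a) by (apply Rabs_le_between; lra).
    assert (Rabs (y - v) <= d - c) by (apply Rabs_le_between; lra).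
    lra.
Qed.

Definition Cint (f : R -> C) (a b : R) : C := RInt (V := C_R_CompleteNormedModule) f a b.

(** The integral of [k(z) dz] along the boundary, counterclockwise, with opposite sides paired. The
    pairing makes constants drop out at once, and the first integral vanishes when [k] takes equal
    values on the two horizontal sides. *)
Definition rect_int (k : C -> C) (a b c d : R) : C :=
  (Cint (fun t => k (t, c) - k (t, d)) a b + Ci * Cint (fun t => k (b, t) - k (a, t)) c d)%C.

Definition ccont_rect (k : C -> C) (a b c d : R) : Prop :=
  forall x y, a <= x <= b -> c <= y <= d -> ccont k (x, y).

Lemma continuous_horizontal k (t y : R) :
  ccont k (t, y) -> @continuous R_UniformSpace C_UniformSpace (fun t => k (t, y)) t.
Proof.
  intros H. apply (continuous_comp (fun t : R_UniformSpace => (t, y) : C_UniformSpace) k);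
    [|exact H].
  apply continuous_C_pair; [apply continuous_id|apply continuous_const].
Qed.

Lemma continuous_vertical k (x t : R) :
  ccont k (x, t) -> @continuous R_UniformSpace C_UniformSpace (fun t => k (x, t)) t.
Proof.
  intros H. apply (continuous_comp (fun t : R_UniformSpace => (x, t) : C_UniformSpace) k);
    [|exact H].
  apply continuous_C_pair; [apply continuous_const|apply continuous_id].
Qed.

Lemma ex_Cint (f : R -> C) (a b : R) :
  a <= b -> (forall t, a <= t <= b -> @continuous R_UniformSpace C_UniformSpace f t) ->
  ex_RInt (V := C_R_NormedModule) f a b.
Proof.
  intros Hab H. apply (ex_RInt_continuous (V := C_R_CompleteNormedModule)). intros t Ht. apply H.
  rewrite Rmin_left, Rmax_right in Ht; assumption.
Qed.

Lemma Cint_Chasles f a b c :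
  ex_RInt (V := C_R_NormedModule) f a b -> ex_RInt (V := C_R_NormedModule) f b c ->
  Cint f a c = (Cint f a b + Cint f b c)%C.
Proof. intros H1 H2. symmetry. exact (RInt_Chasles (V := C_R_CompleteNormedModule) f a b c H1 H2). Qed.

Lemma Cint_plus f g a b :
  ex_RInt (V := C_R_NormedModule) f a b -> ex_RInt (V := C_R_NormedModule) g a b ->
  Cint (fun t => f t + g t)%C a b = (Cint f a b + Cint g a b)%C.
Proof. exact (RInt_plus (V := C_R_CompleteNormedModule) f g a b). Qed.

Lemma Cint_ext f g a b :
  a <= b -> (forall t, a <= t <= b -> f t = g t) -> Cint f a b = Cint g a b.
Proof.
  intros Hab H. apply (RInt_ext (V := C_R_CompleteNormedModule)). intros t Ht.
  rewrite Rmin_left, Rmax_right in Ht by assumption. apply H. lra.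
Qed.

Lemma norm_C_R (z : C) : norm (V := C_R_NormedModule) z = Cmod z.
Proof.
  destruct z as [x y]. change (sqrt (Rabs x ^ 2 + Rabs y ^ 2) = sqrt (x ^ 2 + y ^ 2)).
  rewrite !pow2_abs. reflexivity.
Qed.

Lemma Cint_near_const (f : R -> C) (a b : R) (v : C) (M : R) :
  a <= b -> ex_RInt (V := C_R_NormedModule) f a b ->
  (forall t, a <= t <= b -> Cmod (f t - v) <= M) ->
  Cmod (Cint f a b - RtoC (b - a) * v) <= (b - a) * M.
Proof.
  intros Hab Hex H.
  assert (I1 : is_RInt (V := C_R_NormedModule) f a b (Cint f a b))
    by exact (RInt_correct (V := C_R_CompleteNormedModule) f a b Hex).
  assert (I2 := is_RInt_const (V := C_R_NormedModule) a b v).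
  assert (I3 := is_RInt_minus _ _ _ _ _ _ I1 I2).
  assert (B := norm_RInt_le_const (V := C_R_NormedModule) _ a b _ M Hab
    (fun x Hx => Rle_trans _ _ _ (Req_le _ _ (norm_C_R (f x - v)%C)) (H x Hx)) I3).
  rewrite norm_C_R in B.
  replace (RtoC (b - a) * v)%C with (scal (V := C_R_NormedModule) (b - a) v); [exact B|].
  destruct v as [x y]. unfold Cmult, RtoC; simpl. unfold scal; simpl. unfold prod_scal, scal; simpl.
  unfold mult; simpl. f_equal; ring.
Qed.

Lemma rect_int_split_x k a m b c d :
  a <= m <= b -> c <= d -> ccont_rect k a b c d ->
  rect_int k a b c d = (rect_int k a m c d + rect_int k m b c d)%C.
Proof.
  intros Hm Hcd Hk. unfold rect_int.
  assert (H : forall t, a <= t <= b ->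
    @continuous R_UniformSpace C_UniformSpace (fun t => k (t, c) - k (t, d))%C t).
  { intros t Ht. apply continuous_Cminus; apply continuous_horizontal, Hk; lra. }
  assert (V : forall x x', a <= x <= b -> a <= x' <= b ->
    ex_RInt (V := C_R_NormedModule) (fun t => k (x, t) - k (x', t))%C c d).
  { intros x x' Hx Hx'. apply ex_Cint; [assumption|]. intros t Ht.
    apply continuous_Cminus; apply continuous_vertical, Hk; lra. }
  rewrite (Cint_Chasles _ a m b) by (apply ex_Cint; [lra|]; intros; apply H; lra).
  rewrite (Cint_ext (fun t => k (b, t) - k (a, t))%C
     (fun t => (k (m, t) - k (a, t)) + (k (b, t) - k (m, t)))%C) by (try assumption; intros; ring).
  rewrite Cint_plus by (apply V; lra). ring.
Qed.

Lemma rect_int_split_y k a b c m d :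
  a <= b -> c <= m <= d -> ccont_rect k a b c d ->
  rect_int k a b c d = (rect_int k a b c m + rect_int k a b m d)%C.
Proof.
  intros Hab Hm Hk. unfold rect_int.
  assert (V : forall t, c <= t <= d ->
    @continuous R_UniformSpace C_UniformSpace (fun t => k (b, t) - k (a, t))%C t).
  { intros t Ht. apply continuous_Cminus; apply continuous_vertical, Hk; lra. }
  assert (H : forall y y', c <= y <= d -> c <= y' <= d ->
    ex_RInt (V := C_R_NormedModule) (fun t => k (t, y) - k (t, y'))%C a b).
  { intros y y' Hy Hy'. apply ex_Cint; [assumption|]. intros t Ht.
    apply continuous_Cminus; apply continuous_horizontal, Hk; lra. }
  rewrite (Cint_Chasles (fun t => k (b, t) - k (a, t))%C c m d)
    by (apply ex_Cint; [lra|]; intros; apply V; lra).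
  rewrite (Cint_ext (fun t => k (t, c) - k (t, d))%C
     (fun t => (k (t, c) - k (t, m)) + (k (t, m) - k (t, d)))%C) by (try assumption; intros; ring).
  rewrite Cint_plus by (apply H; lra). ring.
Qed.

(** For an affine function the differences across opposite sides are the constants [B * (0, c - d)]
    and [B * (b - a)], whose contributions cancel. What remains is the error, at most [2 * M]
    because each integrand is a difference of two values of [k]. *)
Lemma rect_int_near_affine k a b c d (A B : C) (M : R) :
  a <= b -> c <= d -> ccont_rect k a b c d ->
  (forall x y, a <= x <= b -> c <= y <= d -> Cmod (k (x, y) - (A + B * (x, y))) <= M) ->
  Cmod (rect_int k a b c d) <= ((b - a) + (d - c)) * (2 * M).
Proof.
  intros Hab Hcd Hk HM.
  assert (D : forall x y x' y', a <= x <= b -> a <= x' <= b -> c <= y <= d -> c <= y' <= d ->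
    Cmod (k (x, y) - k (x', y') - B * ((x, y) - (x', y'))) <= 2 * M).
  { intros x y x' y' Hx Hx' Hy Hy'.
    replace (k (x, y) - k (x', y') - B * ((x, y) - (x', y')))%C with
      ((k (x, y) - (A + B * (x, y))) + - (k (x', y') - (A + B * (x', y'))))%C by ring.
    eapply Rle_trans; [apply Cmod_triangle|]. rewrite Cmod_opp.
    assert (H1 := HM x y Hx Hy). assert (H2 := HM x' y' Hx' Hy'). lra. }
  assert (H1 : Cmod (Cint (fun t => k (t, c) - k (t, d))%C a b
                     - RtoC (b - a) * (B * (0, c - d))) <= (b - a) * (2 * M)).
  { apply Cint_near_const; [assumption| |].
    - apply ex_Cint; [assumption|]. intros t Ht.
      apply continuous_Cminus; apply continuous_horizontal, Hk; lra.
    - intros t Ht.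
      replace (0, c - d) with ((t, c) - (t, d))%C by (unfold Cminus, Cplus, Copp; simpl; f_equal; ring).
      apply D; lra. }
  assert (H2 : Cmod (Cint (fun t => k (b, t) - k (a, t))%C c d
                     - RtoC (d - c) * (B * RtoC (b - a))) <= (d - c) * (2 * M)).
  { apply Cint_near_const; [assumption| |].
    - apply ex_Cint; [assumption|]. intros t Ht.
      apply continuous_Cminus; apply continuous_vertical, Hk; lra.
    - intros t Ht.
      replace (RtoC (b - a)) with ((b, t) - (a, t))%C
        by (unfold RtoC, Cminus, Cplus, Copp; simpl; f_equal; ring).
      apply D; lra. }
  unfold rect_int. revert H1 H2.
  generalize (Cint (fun t => k (t, c) - k (t, d))%C a b) (Cint (fun t => k (b, t) - k (a, t))%C c d).
  intros I J H1 H2.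
  replace (I + Ci * J)%C with
    ((I - RtoC (b - a) * (B * (0%R, (c - d)%R))) + Ci * (J - RtoC (d - c) * (B * RtoC (b - a))))%C.
  - eapply Rle_trans; [apply Cmod_triangle|]. rewrite Cmod_mult, Cmod_Ci. lra.
  - replace (0%R, (c - d)%R) with (- Ci * RtoC (d - c))%C
      by (unfold RtoC, Ci, Cmult, Copp; simpl; f_equal; ring).
    ring.
Qed.

Lemma goursat (k : C -> C) (a b c d : R) :
  a < b -> c < d ->
  (forall x y, a <= x <= b -> c <= y <= d -> cdiff k (x, y)) ->
  rect_int k a b c d = 0%C.
Proof.
  intros Hab Hcd Hk.
  assert (Hc : ccont_rect k a b c d) by (intros x y Hx Hy; apply cdiff_ccont, Hk; assumption).
  apply NNPP. intros Hne. assert (Hpos := proj1 (Cmod_gt_0 _) Hne). clear Hne.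
  set (w := b - a) in *. set (h := d - c) in *.
  assert (Hw : 0 < w) by (unfold w; lra). assert (Hh : 0 < h) by (unfold h; lra).
  (* The ratio of integral to area: integral and area are both additive over the four quarters, so
     some quarter has at least the same ratio. *)
  set (eta := Cmod (rect_int k a b c d) / (w * h)).
  assert (Heta : 0 < eta) by (apply Rdiv_lt_0_compat; [assumption|apply Rmult_lt_0_compat; assumption]).
  destruct (quadrisection
    (fun a' b' c' d' => a <= a' <= b' /\ b' <= b /\ c <= c' <= d' /\ d' <= d /\
       eta * ((b' - a') * (d' - c')) <= Cmod (rect_int k a' b' c' d')) a b c d)
    as (u & v & Huv); try lra.
  - repeat split; try lra. fold w h. unfold eta. apply Req_le. field. split; lra.
  - intros a' b' c' d' (Ha & Hb & Hc' & Hd & HI).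
    set (m := (a' + b') / 2). set (n := (c' + d') / 2).
    assert (Em : m = (a' + b') / 2) by reflexivity. assert (En : n = (c' + d') / 2) by reflexivity.
    assert (Sub : forall a1 b1 c1 d1, a <= a1 -> b1 <= b -> c <= c1 -> d1 <= d ->
       ccont_rect k a1 b1 c1 d1).
    { intros a1 b1 c1 d1 G1 G2 G3 G4 x y Hx Hy. apply Hc; lra. }
    rewrite (rect_int_split_x k a' m b' c' d') in HI by (try apply Sub; lra).
    rewrite (rect_int_split_y k a' m c' n d') in HI by (try apply Sub; lra).
    rewrite (rect_int_split_y k m b' c' n d') in HI by (try apply Sub; lra).
    apply NNPP. intros K. clearbody m n.
    assert (K1 : Cmod (rect_int k a' m c' n) < eta * ((m - a') * (n - c'))).
    { apply Rnot_le_lt. intros K'. apply K. left. repeat split; lra. }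
    assert (K2 : Cmod (rect_int k m b' c' n) < eta * ((b' - m) * (n - c'))).
    { apply Rnot_le_lt. intros K'. apply K. right; left. repeat split; lra. }
    assert (K3 : Cmod (rect_int k a' m n d') < eta * ((m - a') * (d' - n))).
    { apply Rnot_le_lt. intros K'. apply K. right; right; left. repeat split; lra. }
    assert (K4 : Cmod (rect_int k m b' n d') < eta * ((b' - m) * (d' - n))).
    { apply Rnot_le_lt. intros K'. apply K. right; right; right. repeat split; lra. }
    revert HI K1 K2 K3 K4.
    generalize (rect_int k a' m c' n), (rect_int k m b' c' n), (rect_int k a' m n d'),
      (rect_int k m b' n d'). intros I1 I2 I3 I4 HI K1 K2 K3 K4.
    assert (T1 := Cmod_triangle (I1 + I3) (I2 + I4)).
    assert (T2 := Cmod_triangle I1 I3). assert (T3 := Cmod_triangle I2 I4).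
    assert (E : (m - a') * (n - c') + (b' - m) * (n - c') + (m - a') * (d' - n) + (b' - m) * (d' - n)
      = (b' - a') * (d' - c')) by ring.
    rewrite <- E in HI. rewrite !Rmult_plus_distr_l in HI. lra.
  - assert (Hu : a <= u <= b).
    { destruct (Huv 0%nat) as (a' & b' & c' & d' & _ & H1 & H2 & _). lra. }
    assert (Hv : c <= v <= d).
    { destruct (Huv 0%nat) as (a' & b' & c' & d' & _ & _ & _ & H1 & H2 & _). lra. }
    destruct (Hk u v Hu Hv) as [phi [Hphi Ephi]].
    (* Chosen so that the upper bound [2 * e * ((w + h) / 2 ^ n) ^ 2] for the small rectangle is
       half of its lower bound [eta * (w * h) / 4 ^ n]. *)
    set (e := eta * (w * h) / (4 * ((w + h) * (w + h)))).
    assert (He : 0 < e).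
    { assert (0 < eta * (w * h)) by (apply Rmult_lt_0_compat; [|apply Rmult_lt_0_compat]; assumption).
      assert (0 < (w + h) * (w + h)) by (apply Rmult_lt_0_compat; lra).
      apply Rdiv_lt_0_compat; lra. }
    destruct (proj1 (ccont_eps _ _) Hphi e He) as [r [Hr Hphi']].
    destruct (half_pow_small (w + h) r Hr) as [n Hn].
    destruct (Huv n) as (a' & b' & c' & d' & (_ & _ & _ & _ & HI) & Ha & Hb & Hc' & Hd & E1 & E2).
    fold w in E1. fold h in E2.
    assert (Hp : 0 < 2 ^ n) by (apply pow_lt; lra).
    assert (Es : (w + h) / 2 ^ n = w / 2 ^ n + h / 2 ^ n) by (field; lra).
    assert (B := rect_int_near_affine k a' b' c' d' (k (u, v) - phi (u, v) * (u, v))%C (phi (u, v))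
                   (e * (w / 2 ^ n + h / 2 ^ n))).
    cut (Cmod (rect_int k a' b' c' d') <= (b' - a' + (d' - c')) * (2 * (e * (w / 2 ^ n + h / 2 ^ n)))).
    + intros B'. rewrite E1, E2 in *.
      assert (F1 : eta * (w / 2 ^ n * (h / 2 ^ n)) = eta * (w * h) / (2 ^ n * 2 ^ n)) by (field; lra).
      assert (F2 : (w / 2 ^ n + h / 2 ^ n) * (2 * (e * (w / 2 ^ n + h / 2 ^ n)))
        = eta * (w * h) / (2 ^ n * 2 ^ n) / 2) by (unfold e; field; lra).
      assert (0 < eta * (w * h) / (2 ^ n * 2 ^ n)).
      { apply Rdiv_lt_0_compat; [|apply Rmult_lt_0_compat; assumption].
        apply Rmult_lt_0_compat; [|apply Rmult_lt_0_compat]; assumption. }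
      lra.
    + apply B; try lra.
      * intros x y Hx Hy. apply Hc; lra.
      * intros x y Hx Hy. rewrite (Ephi (x, y)).
        replace (k (u, v) + phi (x, y) * ((x, y) - (u, v)) -
          (k (u, v) - phi (u, v) * (u, v) + phi (u, v) * (x, y)))%C
          with ((phi (x, y) - phi (u, v)) * ((x, y) - (u, v)))%C by ring.
        rewrite Cmod_mult.
        assert (Dist : Cmod ((x, y) - (u, v)) <= w / 2 ^ n + h / 2 ^ n).
        { eapply Rle_trans; [apply (Cmod_le_abs (x - u) (y - v))|].
          apply Rplus_le_compat; apply Rabs_le_between; lra. }
        apply Rmult_le_compat; try apply Cmod_ge_0; [|assumption].
        left. apply Hphi'. lra.
Qed.

(** * Mean value property and the Phragmen-Lindelof principle *)

Lemma derivable_pt_lim_0_bound (f : R -> R) (l e : R) :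
  derivable_pt_lim f 0 l -> 0 < e ->
  exists d, 0 < d /\ forall h, Rabs h < d -> Rabs (f h - f 0 - l * h) <= e * Rabs h.
Proof.
  intros H He. destruct (H e He) as [d Hd]. exists d. split; [apply cond_pos|].
  intros h Hh. destruct (Req_dec h 0) as [->|Hn].
  - replace (f 0 - f 0 - l * 0) with 0 by ring. rewrite Rabs_R0. lra.
  - specialize (Hd h Hn Hh). rewrite Rplus_0_l in Hd.
    replace (f h - f 0 - l * h) with (((f h - f 0) / h - l) * h) by (field; assumption).
    rewrite Rabs_mult. apply Rmult_le_compat_r; [apply Rabs_pos|lra].
Qed.

Definition Cexp (z : C) : C := (exp (Re z) * cos (Im z), exp (Re z) * sin (Im z)).

Lemma Cexp_plus (z w : C) : Cexp (z + w) = (Cexp z * Cexp w)%C.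
Proof.
  destruct z as [a b], w as [c d]. unfold Cexp, Cplus, Cmult; simpl.
  rewrite exp_plus, cos_plus, sin_plus. f_equal; ring.
Qed.

Lemma Cmod_Cexp (z : C) : Cmod (Cexp z) = exp (Re z).
Proof.
  unfold Cexp, Cmod; simpl.
  replace (_ + _) with (exp (Re z) * exp (Re z) * (Rsqr (sin (Im z)) + Rsqr (cos (Im z))))
    by (unfold Rsqr; ring).
  rewrite sin2_cos2, Rmult_1_r. apply sqrt_square. left; apply exp_pos.
Qed.

Lemma Cexp_small (e : R) : 0 < e ->
  exists d, 0 < d /\ forall z, Cmod z < d -> Cmod (Cexp z - 1 - z) <= e * Cmod z.
Proof.
  (* [T1] and [T2] below add up to at most [6 * e1 * |y| + 3 * e1 * |x|], whence the 9. The cap at 1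
     gives [|exp x - 1| <= 2 * |x|] and [exp x <= 3]. *)
  intros He. set (e1 := Rmin (e / 9) 1).
  assert (He1 : 0 < e1) by (apply Rmin_glb_lt; lra).
  assert (M1 : e1 <= e / 9) by apply Rmin_l. assert (M2 : e1 <= 1) by apply Rmin_r.
  clearbody e1.
  destruct (derivable_pt_lim_0_bound exp 1 e1 derivable_pt_lim_exp_0 He1) as [d1 [D1 H1]].
  destruct (derivable_pt_lim_0_bound sin 1 e1 derivable_pt_lim_sin_0 He1) as [d2 [D2 H2]].
  assert (Hcos : derivable_pt_lim cos 0 0).
  { replace 0 with (- sin 0) at 2 by (rewrite sin_0; ring). apply derivable_pt_lim_cos. }
  destruct (derivable_pt_lim_0_bound cos 0 e1 Hcos He1) as [d3 [D3 H3]].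
  exists (Rmin (Rmin d1 d2) (Rmin d3 e1)). split; [repeat apply Rmin_glb_lt; assumption|].
  intros [x y] Hz.
  assert (B1 := Rmin_l (Rmin d1 d2) (Rmin d3 e1)). assert (B2 := Rmin_r (Rmin d1 d2) (Rmin d3 e1)).
  assert (B3 := Rmin_l d1 d2). assert (B4 := Rmin_r d1 d2).
  assert (B5 := Rmin_l d3 e1). assert (B6 := Rmin_r d3 e1).
  assert (X := Rmax_Cmod (x, y)). simpl in X.
  assert (X1 := Rmax_l (Rabs x) (Rabs y)). assert (X2 := Rmax_r (Rabs x) (Rabs y)).
  specialize (H1 x ltac:(lra)). specialize (H2 y ltac:(lra)). specialize (H3 y ltac:(lra)).
  rewrite exp_0 in H1. rewrite sin_0 in H2. rewrite cos_0 in H3.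
  assert (P1 := Rabs_pos x). assert (P2 := Rabs_pos y).
  assert (Hx2 : Rabs (exp x - 1) <= 2 * Rabs x).
  { replace (exp x - 1) with ((exp x - 1 - 1 * x) + x) by ring.
    eapply Rle_trans; [apply Rabs_triang|]. nra. }
  assert (Hx3 : Rabs (exp x) <= 3).
  { replace (exp x) with (exp x - 1 + 1) by ring.
    eapply Rle_trans; [apply Rabs_triang|]. rewrite Rabs_R1. lra. }
  replace (Cexp (x, y) - 1 - (x, y))%C with
    (exp x * (cos y - 1 - 0 * y) + (exp x - 1 - 1 * x), exp x * (sin y - 0 - 1 * y) + (exp x - 1) * y)
    by (unfold Cexp, Cminus, Cplus, Copp, RtoC; simpl; f_equal; ring).
  eapply Rle_trans; [apply Cmod_le_abs|].
  assert (T1 : Rabs (exp x * (cos y - 1 - 0 * y) + (exp x - 1 - 1 * x)) <= 3 * (e1 * Rabs y) + e1 * Rabs x).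
  { eapply Rle_trans; [apply Rabs_triang|]. rewrite Rabs_mult. apply Rplus_le_compat; [|lra].
    apply Rmult_le_compat; try apply Rabs_pos; lra. }
  assert (T2 : Rabs (exp x * (sin y - 0 - 1 * y) + (exp x - 1) * y) <= 3 * (e1 * Rabs y) + 2 * Rabs x * e1).
  { eapply Rle_trans; [apply Rabs_triang|]. rewrite !Rabs_mult. apply Rplus_le_compat.
    - apply Rmult_le_compat; try apply Rabs_pos; lra.
    - apply Rmult_le_compat; try apply Rabs_pos; lra. }
  assert (Hc := Cmod_ge_0 (x, y)).
  nra.
Qed.

Lemma cdiff_Cexp z : cdiff Cexp z.
Proof.
  assert (E0 : Cexp 0 = RtoC 1).
  { unfold Cexp, RtoC; simpl. rewrite exp_0, cos_0, sin_0. f_equal; ring. }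
  assert (D0 : cdiff Cexp 0).
  { exists (fun w => if Ceq_dec w 0 then RtoC 1 else ((Cexp w - 1) / w)%C). split.
    - apply ccont_eps. intros e He. destruct (Cexp_small (e / 2)) as [d [Hd H]]; [lra|].
      exists d. split; [assumption|]. intros w Hw.
      replace (w - 0)%C with w in Hw by ring. specialize (H w Hw).
      destruct (Ceq_dec 0 0) as [_|]; [|congruence].
      destruct (Ceq_dec w 0) as [->|E].
      + replace (1 - 1)%C with (RtoC 0) by ring. rewrite Cmod_0. assumption.
      + replace ((Cexp w - 1) / w - 1)%C with ((Cexp w - 1 - w) / w)%C by (field; assumption).
        rewrite Cmod_div by assumption. assert (0 < Cmod w) by (apply Cmod_gt_0; assumption).
        apply Rlt_div_l; nra.
    - intros w. rewrite E0. destruct (Ceq_dec w 0) as [->|E].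
      + rewrite E0. ring.
      + field. assumption. }
  assert (D1 : cdiff (fun w => Cexp z * Cexp (w - z))%C z).
  { apply cdiff_mult; [apply cdiff_const|].
    apply (cdiff_comp Cexp (fun w => w - z)%C).
    - apply (cdiff_minus (fun w => w) (fun _ => z)); [apply cdiff_id|apply cdiff_const].
    - replace (z - z)%C with (RtoC 0) by ring. exact D0. }
  destruct D1 as [phi [Hphi E]]. exists phi. split; [assumption|]. intros w.
  replace w with (z + (w - z))%C at 1 by ring. rewrite Cexp_plus, (E w).
  replace (z - z)%C with (RtoC 0) by ring. rewrite E0. ring.
Qed.

(* In the coordinates [z = c + exp (x + i y)] the two horizontal sides of the rectangle
   [x0, x1] * [0, 2 pi] cancel, so the mean of [h] over a circle does not depend on its radius. *)
Lemma maximum_at_center (h : C -> C) (c : C) (r theta : R) :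
  0 < r -> (forall z, Cmod (z - c) <= r -> cdiff h z) ->
  (forall z, Cmod (z - c) = r -> Cmod (h z) <= theta) ->
  Cmod (h c) <= theta.
Proof.
  intros Hr Hd Hb. apply Rnot_lt_le. intros Hlt.
  set (e := (Cmod (h c) - theta) / 2). assert (He : 0 < e) by (unfold e; lra).
  assert (Hc : ccont h c).
  { apply cdiff_ccont, Hd. replace (c - c)%C with (RtoC 0) by ring. rewrite Cmod_0. lra. }
  destruct (proj1 (ccont_eps _ _) Hc e He) as [d [Hdp Hde]].
  set (k := fun z => h (c + Cexp z)%C).
  set (x1 := ln r). set (x0 := ln (Rmin d r / 2)).
  assert (Hm : 0 < Rmin d r) by (apply Rmin_glb_lt; assumption).
  assert (Hmd := Rmin_l d r). assert (Hmr := Rmin_r d r).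
  assert (Ex1 : exp x1 = r) by (apply exp_ln; assumption).
  assert (Ex0 : exp x0 = Rmin d r / 2) by (apply exp_ln; lra).
  assert (Hx : x0 < x1) by (apply exp_lt_inv; lra).
  assert (Hpi := PI_RGT_0).
  assert (Mod : forall x y, Cmod (c + Cexp (x, y) - c) = exp x).
  { intros x y. replace (c + Cexp (x, y) - c)%C with (Cexp (x, y)) by ring. apply Cmod_Cexp. }
  assert (Hk : forall x y, x <= x1 -> cdiff k (x, y)).
  { intros x y Hxy. apply (cdiff_comp h (fun z => c + Cexp z)%C).
    - apply cdiff_plus; [apply cdiff_const|apply cdiff_Cexp].
    - apply Hd. rewrite Mod, <- Ex1.
      destruct Hxy as [Hxy| ->]; [left; apply exp_increasing; assumption|right; reflexivity]. }
  assert (G := goursat k x0 x1 0 (2 * PI) Hx ltac:(lra) (fun x y Hx _ => Hk x y (proj2 Hx))).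
  unfold rect_int in G.
  assert (G1 : Cint (fun t => k (t, 0%R) - k (t, (2 * PI)%R))%C x0 x1 = RtoC 0).
  { rewrite (Cint_ext _ (fun _ => RtoC 0)); [|lra|].
    - apply (eq_trans (RInt_const (V := C_R_CompleteNormedModule) x0 x1 (RtoC 0))).
      apply (scal_zero_r (V := C_R_NormedModule)).
    - intros t _. unfold k, Cexp; simpl. rewrite cos_0, sin_0, cos_2PI, sin_2PI. ring. }
  rewrite G1 in G.
  (* The outer circle contributes at most [theta], and on the inner one [h] is within [e] of [h c];
     so the integrand is within [theta + e] of [- h c]. As its integral is 0, this forces
     [|h c| <= theta + e], too small by the choice of [e]. *)
  assert (N := Cint_near_const (fun t => k (x1, t) - k (x0, t))%C 0 (2 * PI) (- h c)%C (theta + e)).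
  assert (G2 : Cint (fun t => k (x1, t) - k (x0, t))%C 0 (2 * PI) = RtoC 0).
  { set (J := Cint _ _ _) in *.
    replace J with (- Ci * (0 + Ci * J))%C.
    - rewrite G. ring.
    - replace (- Ci * (0 + Ci * J))%C with (- (Ci * Ci) * J)%C by ring.
      replace (Ci * Ci)%C with (- RtoC 1)%C by (unfold Ci, Cmult, Copp, RtoC; simpl; f_equal; ring).
      ring. }
  rewrite G2 in N.
  assert (N' : Cmod (0 - RtoC (2 * PI - 0) * - h c) <= (2 * PI - 0) * (theta + e)).
  { apply N; [lra| |].
    - apply ex_Cint; [lra|]. intros t Ht.
      apply continuous_Cminus; apply continuous_vertical, cdiff_ccont, Hk; lra.
    - intros t Ht.
      replace (k (x1, t) - k (x0, t) - - h c)%C with (k (x1, t) + - (k (x0, t) - h c))%C by ring.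
      eapply Rle_trans; [apply Cmod_triangle|]. rewrite Cmod_opp. apply Rplus_le_compat.
      + apply Hb. rewrite Mod. assumption.
      + left. apply Hde. rewrite Mod, Ex0. lra. }
  replace (0 - RtoC (2 * PI - 0) * - h c)%C with (RtoC (2 * PI - 0) * h c)%C in N' by ring.
  rewrite Cmod_mult, Cmod_R, Rabs_pos_eq in N' by lra.
  apply Rmult_le_reg_l in N'; [|lra]. unfold e in N'. lra.
Qed.

(* At a maximum [c], multiplying [q] by the affine function [1 + conj (c - z0) (z - c) / B]
   absorbs the weight up to a strictly positive quadratic gain, contradicting the
   mean value property. *)
Lemma weighted_modulus_no_interior_max (q : C -> C) (c z0 : C) (d r : R) :
  0 < d -> 0 < r -> (forall z, Cmod (z - c) <= r -> cdiff q z) ->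
  (forall z, Cmod (z - c) <= r ->
     Cmod (q z) ^ 2 * (d ^ 2 + Cmod (z - z0) ^ 2) <= Cmod (q c) ^ 2 * (d ^ 2 + Cmod (c - z0) ^ 2)) ->
  q c = RtoC 0.
Proof.
  intros Hd Hr Hq Hmax. apply NNPP. intros Hne. apply Cmod_gt_0 in Hne.
  set (a := (c - z0)%C) in *. set (B := d ^ 2 + Cmod a ^ 2) in *.
  assert (Ha := Cmod_ge_0 a).
  assert (Hd2 : 0 < d ^ 2) by (apply pow_lt; assumption).
  assert (Hr2 : 0 < r ^ 2) by (apply pow_lt; assumption).
  assert (HB : 0 < B) by (unfold B; generalize (pow2_ge_0 (Cmod a)); lra).
  set (W := d ^ 2 + (Cmod a + r) ^ 2).
  assert (HW : r ^ 2 < W) by (unfold W; nra).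
  (* On the circle the weight is at most [W] while the gain is [d ^ 2 * r ^ 2 / B]; so at least the
     fraction [1 - kappa] of the weight is gained, uniformly along the circle. *)
  set (kappa := 1 - d ^ 2 * r ^ 2 / (B * W)).
  assert (HBW : 0 < B * W) by (apply Rmult_lt_0_compat; lra).
  assert (HBd : d ^ 2 <= B) by (unfold B; generalize (pow2_ge_0 (Cmod a)); lra).
  assert (Hk1 : 0 < d ^ 2 * r ^ 2 / (B * W)).
  { apply Rdiv_lt_0_compat; [apply Rmult_lt_0_compat|]; assumption. }
  assert (Hk0 : d ^ 2 * r ^ 2 / (B * W) <= 1).
  { apply Rle_div_l; [assumption|]. rewrite Rmult_1_l. apply Rmult_le_compat; lra. }
  set (h := fun z => (q z * (1 + Cconj a * (z - c) * RtoC (/ B)))%C).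
  assert (Hhc : h c = q c) by (unfold h; ring).
  assert (K : Cmod (h c) <= sqrt kappa * Cmod (q c)).
  { apply maximum_at_center with r; [assumption| |].
    - intros z Hz. apply cdiff_mult; [apply Hq, Hz|].
      apply cdiff_plus; [apply cdiff_const|]. apply cdiff_mult; [|apply cdiff_const].
      apply cdiff_mult; [apply cdiff_const|].
      apply (cdiff_minus (fun z => z)); [apply cdiff_id|apply cdiff_const].
    - intros z Hz. specialize (Hmax z (Req_le _ _ Hz)).
      set (e := (z - c)%C) in *.
      assert (Eu : (z - z0)%C = (a + e)%C) by (unfold a, e; ring). rewrite Eu in Hmax.
      (* Both sides have the same cross term [2 Re (conj a * e)]; the rest is
         [r ^ 2 * (1 - |a| ^ 2 / B)], which equals [d ^ 2 * r ^ 2 / B]. *)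
      assert (Id : d ^ 2 + Cmod (a + e) ^ 2
                   = B * Cmod (1 + Cconj a * e * RtoC (/ B)) ^ 2 + d ^ 2 * r ^ 2 / B).
      { rewrite <- Hz. unfold B. rewrite !Cmod2_alt. unfold B in HB. rewrite Cmod2_alt in HB.
        clearbody a e. clear - HB. destruct a as [a1 a2], e as [e1 e2].
        unfold Cconj, Cplus, Cmult, RtoC in *; simpl in *. field. lra. }
      assert (Wle : d ^ 2 + Cmod (a + e) ^ 2 <= W).
      { unfold W. apply Rplus_le_compat_l. apply pow_incr. split; [apply Cmod_ge_0|].
        rewrite <- Hz. apply Cmod_triangle. }
      assert (Hh : Cmod (h z) ^ 2 <= kappa * Cmod (q c) ^ 2).
      { unfold h. fold e. rewrite Cmod_mult, Rpow_mult_distr.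
        set (T := Cmod (1 + Cconj a * e * RtoC (/ B)) ^ 2) in *.
        set (V := d ^ 2 + Cmod (a + e) ^ 2) in *.
        assert (HT : T = (V - d ^ 2 * r ^ 2 / B) / B) by (rewrite Id; field; lra).
        assert (HX := pow2_ge_0 (Cmod (q z))). set (X := Cmod (q z) ^ 2) in *.
        set (Y := Cmod (q c) ^ 2) in *.
        assert (HV : V - d ^ 2 * r ^ 2 / B <= V * kappa).
        { unfold kappa.
          replace (V * (1 - d ^ 2 * r ^ 2 / (B * W))) with (V - V / W * (d ^ 2 * r ^ 2 / B))
            by (field; lra).
          assert (V / W <= 1) by (apply Rle_div_l; lra).
          assert (0 < d ^ 2 * r ^ 2 / B) by (apply Rdiv_lt_0_compat; [apply Rmult_lt_0_compat|]; assumption).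
          nra. }
        rewrite HT. replace (X * ((V - d ^ 2 * r ^ 2 / B) / B)) with (X * (V - d ^ 2 * r ^ 2 / B) / B)
          by (field; lra).
        apply Rle_div_l; [assumption|].
        apply Rle_trans with (X * V * kappa).
        - rewrite Rmult_assoc. apply Rmult_le_compat_l; assumption.
        - replace (kappa * Y * B) with (Y * B * kappa) by ring.
          apply Rmult_le_compat_r; [unfold kappa; lra|assumption]. }
      apply Rsqr_incr_0_var.
      + unfold Rsqr. replace (Cmod (h z) * Cmod (h z)) with (Cmod (h z) ^ 2) by ring.
        replace (sqrt kappa * Cmod (q c) * (sqrt kappa * Cmod (q c)))
          with (sqrt kappa * sqrt kappa * Cmod (q c) ^ 2) by ring.
        rewrite sqrt_sqrt by (unfold kappa; lra). assumption.
      + apply Rmult_le_pos; [apply sqrt_pos|apply Cmod_ge_0]. }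
  rewrite Hhc in K.
  assert (sqrt kappa < 1).
  { rewrite <- sqrt_1. apply sqrt_lt_1; unfold kappa; lra. }
  nra.
Qed.

(** Outside the disc of radius [d] the weight is at most [2 * |u| ^ 2]. It thus consumes only half
    of the decay of [|u| ^ -4], and the surviving [|u| ^ -2] is what keeps near-maximal points
    bounded. *)
Lemma weight_bound (f u : C) (d : R) : 0 < d -> d <= Cmod u ->
  Cmod (f * / (u ^ 2)) ^ 2 * (d ^ 2 + Cmod u ^ 2) <= 2 * Cmod f ^ 2 / Cmod u ^ 2.
Proof.
  intros Hd Hu.
  assert (Hu0 : u <> RtoC 0) by (intros ->; rewrite Cmod_0 in Hu; lra).
  assert (Hp : (u ^ 2)%C <> RtoC 0).
  { simpl. rewrite Cmult_1_r. apply Cmult_neq_0; assumption. }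
  rewrite Cmod_mult, Cmod_inv, Cmod_pow by assumption.
  set (U := Cmod u) in *. set (X := Cmod f).
  replace ((X * / U ^ 2) ^ 2 * (d ^ 2 + U ^ 2)) with (X ^ 2 / U ^ 2 * ((d ^ 2 + U ^ 2) / U ^ 2))
    by (field; lra).
  replace (2 * X ^ 2 / U ^ 2) with (X ^ 2 / U ^ 2 * 2) by (field; lra).
  assert (0 < U ^ 2) by (apply pow_lt; lra).
  apply Rmult_le_compat_l.
  - apply Rdiv_le_0_compat; [apply pow2_ge_0|assumption].
  - apply Rle_div_l; [assumption|]. assert (d ^ 2 <= U ^ 2) by (apply pow_incr; lra). lra.
Qed.

Definition in_closure (U : C -> Prop) (z : C) : Prop :=
  forall e, 0 < e -> exists w, U w /\ Cmod (w - z) < e.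

(* Phragmen-Lindelof: a high power of [F] dominates the factor [(z - z0)^-2], which in turn
   forces decay at infinity and so produces an interior maximum if the bound [m] fails. *)
Lemma phragmen_lindelof (U : C -> Prop) (F : C -> C) (z0 : C) (d m M : R) :
  0 < d -> 0 < m ->
  (forall z, U z -> exists r, 0 < r /\ forall w, Cmod (w - z) <= r -> U w) ->
  (forall z, U z -> cdiff F z /\ d <= Cmod (z - z0) /\ Cmod (F z) <= M) ->
  (forall z, in_closure U z -> ~ U z -> ccont F z /\ Cmod (F z) <= m) ->
  forall p, U p -> Cmod (F p) <= m.
Proof.
  intros Hd Hm Hop HU Hbd p Hp. apply Rnot_lt_le. intros Hlt.
  destruct (HU p Hp) as [_ [Hdp _]].
  set (s := Cmod (p - z0)) in *.
  (* This [n] makes [Phi p] exceed [4 * (m ^ n) ^ 2 / d ^ 2], whereas on the boundary [weight_bound]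
     allows at most [2 * (m ^ n) ^ 2 / d ^ 2]. *)
  destruct (Pow_x_infinity (Cmod (F p) / m)) with (b := 2 * s / d) as [n Hn].
  { rewrite Rabs_pos_eq.
    - apply Rlt_gt, Rlt_div_r; lra.
    - apply Rdiv_le_0_compat; [apply Cmod_ge_0|assumption]. }
  specialize (Hn n (le_n n)).
  set (q := fun z => (F z ^ n * / ((z - z0) ^ 2))%C).
  set (Phi := fun z => Cmod (q z) ^ 2 * (d ^ 2 + Cmod (z - z0) ^ 2)).
  assert (Hmn : 0 < m ^ n) by (apply pow_lt; assumption).
  assert (Hd2 : 0 < d ^ 2) by (apply pow_lt; assumption).
  assert (Hs2 : 0 < s ^ 2) by (apply pow_lt; lra).
  assert (HPp : 2 * (m ^ n) ^ 2 / d ^ 2 < Phi p).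
  { apply Rlt_le_trans with ((Cmod (F p) ^ n) ^ 2 / s ^ 2).
    - assert (Hn' : m ^ n * (2 * s / d) <= Cmod (F p) ^ n).
      { rewrite Rabs_pos_eq in Hn.
        - replace (Cmod (F p) ^ n) with (m ^ n * (Cmod (F p) / m) ^ n).
          + apply Rmult_le_compat_l; lra.
          + rewrite <- Rpow_mult_distr. f_equal. field. lra.
        - apply pow_le, Rdiv_le_0_compat; [apply Cmod_ge_0|assumption]. }
      assert (H0 : 0 <= m ^ n * (2 * s / d)).
      { apply Rmult_le_pos; [lra|]. apply Rdiv_le_0_compat; lra. }
      assert (Hn2 := pow_incr _ _ 2 (conj H0 Hn')).
      apply Rlt_le_trans with ((m ^ n * (2 * s / d)) ^ 2 / s ^ 2).
      + replace ((m ^ n * (2 * s / d)) ^ 2 / s ^ 2) with (4 * (m ^ n) ^ 2 / d ^ 2) by (field; lra).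
        assert (0 < (m ^ n) ^ 2) by (apply pow_lt; assumption).
        apply Rmult_lt_compat_r; [apply Rinv_0_lt_compat; assumption|lra].
      + apply Rmult_le_compat_r; [left; apply Rinv_0_lt_compat; assumption|assumption].
    - unfold Phi, q. fold s.
      assert (Hp0 : ((p - z0) ^ 2)%C <> RtoC 0).
      { apply Cmod_gt_0. rewrite Cmod_pow. assumption. }
      rewrite Cmod_mult, Cmod_inv by assumption. rewrite !Cmod_pow. fold s.
      replace ((Cmod (F p) ^ n * / s ^ 2) ^ 2 * (d ^ 2 + s ^ 2))
        with ((Cmod (F p) ^ n) ^ 2 / s ^ 2 * ((d ^ 2 + s ^ 2) / s ^ 2)) by (field; lra).
      rewrite <- (Rmult_1_r (_ / s ^ 2)) at 1. apply Rmult_le_compat_l.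
      + apply Rdiv_le_0_compat; [apply pow2_ge_0|assumption].
      + apply Rle_div_r; lra. }
  assert (HPp0 : 0 < Phi p).
  { apply Rle_lt_trans with (2 := HPp). apply Rdiv_le_0_compat; [|assumption].
    generalize (pow2_ge_0 (m ^ n)). lra. }
  assert (Far : forall z, U z -> Phi z * Cmod (z - z0) ^ 2 <= 2 * (M ^ n) ^ 2).
  { intros z Hz. destruct (HU z Hz) as (_ & Hz1 & Hz2).
    assert (0 < Cmod (z - z0) ^ 2) by (apply pow_lt; lra).
    apply Rle_div_r; [assumption|].
    eapply Rle_trans; [apply (weight_bound (F z ^ n)%C (z - z0)%C d); assumption|].
    apply Rmult_le_compat_r; [left; apply Rinv_0_lt_compat; assumption|].
    apply Rmult_le_compat_l; [lra|]. rewrite Cmod_pow.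
    apply pow_incr. split; [apply pow_le, Cmod_ge_0|].
    apply pow_incr. split; [apply Cmod_ge_0|assumption]. }
  assert (Pos : forall z, 0 <= Phi z).
  { intros z. apply Rmult_le_pos; [apply pow2_ge_0|]. generalize (pow2_ge_0 (Cmod (z - z0))). lra. }
  destruct (completeness (fun y => exists z, U z /\ y = Phi z)) as [S [HS1 HS2]].
  { exists (2 * (M ^ n) ^ 2 / d ^ 2). intros y (z & Hz & ->).
    apply (proj1 (Rle_div_r _ _ _ Hd2)). apply Rle_trans with (2 := Far z Hz).
    apply Rmult_le_compat_l; [apply Pos|]. apply pow_incr. destruct (HU z Hz) as (_ & ? & _). lra. }
  { exists (Phi p), p. split; [assumption|reflexivity]. }
  assert (Sup : forall z, U z -> Phi z <= S) by (intros z Hz; apply HS1; exists z; tauto).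
  assert (HSp := Sup p Hp).
  assert (HS0 : 0 < S) by lra.
  (* By [Far], a point with [Phi z > S / 2] has [|z - z0| ^ 2 <= 4 * (M ^ n) ^ 2 / S]; adding 1 to
     the right side bounds [|z - z0|] itself without a square root. *)
  destruct (bounded_cluster_point (fun e z => U z /\ S - e < Phi z)
              (Cmod z0 + (4 * (M ^ n) ^ 2 / S + 1))) as [zeta Hzeta].
  { intros e e' z He [H1 H2]. split; [assumption|lra]. }
  { intros e He. apply NNPP. intros N.
    assert (S <= S - Rmin e (S / 2)).
    { apply HS2. intros y (z & Hz & ->). apply Rnot_lt_le. intros K. apply N. exists z.
      assert (M1 := Rmin_l e (S / 2)). assert (M2 := Rmin_r e (S / 2)).
      split; [split; [assumption|lra]|].
      assert (HF := Far z Hz).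
      replace z with (z0 + (z - z0))%C by ring.
      eapply Rle_trans; [apply Cmod_triangle|]. apply Rplus_le_compat_l.
      replace (z0 + (z - z0) - z0)%C with (z - z0)%C by ring.
      set (t := Cmod (z - z0)) in *.
      assert (t ^ 2 <= 4 * (M ^ n) ^ 2 / S).
      { apply (proj1 (Rle_div_r _ _ _ HS0)). assert (0 <= t ^ 2) by apply pow2_ge_0. nra. }
      assert (0 <= 4 * (M ^ n) ^ 2 / S).
      { apply Rdiv_le_0_compat; [|lra]. generalize (pow2_ge_0 (M ^ n)). lra. }
      nra. }
    assert (0 < Rmin e (S / 2)) by (apply Rmin_glb_lt; lra). lra. }
  assert (Dist : d <= Cmod (zeta - z0)).
  { apply Rnot_lt_le. intros K. destruct (Hzeta (d - Cmod (zeta - z0))) as (z & [Hz _] & Hzz); [lra|].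
    destruct (HU z Hz) as (_ & Hz' & _).
    replace (z - z0)%C with ((z - zeta) + (zeta - z0))%C in Hz' by ring.
    assert (T := Cmod_triangle (z - zeta) (zeta - z0)). lra. }
  assert (Hne : ((zeta - z0) ^ 2)%C <> RtoC 0).
  { apply Cmod_gt_0. rewrite Cmod_pow. apply pow_lt. lra. }
  assert (Hcl : in_closure U zeta).
  { intros e He. destruct (Hzeta e He) as (z & [Hz _] & Hzz). exists z. tauto. }
  assert (HF : ccont F zeta).
  { destruct (classic (U zeta)) as [K|K]; [apply cdiff_ccont, HU, K|apply Hbd; assumption]. }
  assert (HPhi : @continuous C_UniformSpace R_UniformSpace Phi zeta).
  { assert (Hu : ccont (fun z => z - z0)%C zeta)
      by (apply continuous_Cminus; [apply continuous_Cid|apply continuous_const]).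
    assert (Hq : continuous (fun z => Cmod (q z)) zeta).
    { apply continuous_Cmod, continuous_Cmult; [apply continuous_Cpow, HF|].
      apply continuous_Cinv; [|assumption].
      apply (continuous_Cpow (U := C_UniformSpace) (fun z => z - z0)%C), Hu. }
    assert (Hu' := continuous_Cmod _ _ Hu).
    apply (continuous_mult (K := R_AbsRing)).
    - apply (continuous_mult (K := R_AbsRing)); [exact Hq|].
      apply (continuous_mult (K := R_AbsRing)); [exact Hq|apply continuous_const].
    - apply (continuous_plus (V := R_NormedModule)); [apply continuous_const|].
      apply (continuous_mult (K := R_AbsRing)); [exact Hu'|].
      apply (continuous_mult (K := R_AbsRing)); [exact Hu'|apply continuous_const]. }
  assert (HS : S <= Phi zeta).
  { apply Rnot_lt_le. intros K. set (e := (S - Phi zeta) / 2).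
    assert (He : 0 < e) by (unfold e; lra).
    assert (L := proj1 (filterlim_locally Phi (Phi zeta)) HPhi (mkposreal e He)).
    apply locally_Cmod in L. destruct L as [r [Hr L]].
    destruct (Hzeta (Rmin r e)) as (z & [Hz Hz2] & Hz3); [apply Rmin_glb_lt; assumption|].
    assert (M1 := Rmin_l r e). assert (M2 := Rmin_r r e).
    specialize (L z ltac:(lra)). change (Rabs (Phi z - Phi zeta) < e) in L.
    apply Rabs_def2 in L. unfold e in *. lra. }
  (* The supremum is reached at [zeta]. Inside [U] the absence of interior maxima is contradicted,
     on the boundary the choice of [n]. *)
  destruct (classic (U zeta)) as [K|K].
  - destruct (Hop zeta K) as [r [Hr Hball]].
    assert (Q : q zeta = RtoC 0).
    { apply weighted_modulus_no_interior_max with z0 d r; try assumption.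
      - intros z Hz. destruct (HU z (Hball z Hz)) as (Dz & Hzd & _).
        apply cdiff_mult; [apply cdiff_pow, Dz|]. apply cdiff_inv.
        + apply (cdiff_pow (fun z => z - z0)%C).
          apply (cdiff_minus (fun z => z)); [apply cdiff_id|apply cdiff_const].
        + apply Cmod_gt_0. rewrite Cmod_pow. apply pow_lt. lra.
      - intros z Hz. change (Phi z <= Phi zeta). specialize (Sup z (Hball z Hz)). lra. }
    assert (Phi zeta = 0) by (unfold Phi; rewrite Q, Cmod_0; ring). lra.
  - destruct (Hbd zeta Hcl K) as [_ HFm].
    assert (WB := weight_bound (F zeta ^ n)%C (zeta - z0)%C d Hd Dist).
    change (Phi zeta <= 2 * Cmod (F zeta ^ n) ^ 2 / Cmod (zeta - z0) ^ 2) in WB.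
    rewrite Cmod_pow in WB.
    assert (H1 : 0 < Cmod (zeta - z0) ^ 2) by (apply pow_lt; lra).
    assert (H2 : d ^ 2 <= Cmod (zeta - z0) ^ 2) by (apply pow_incr; lra).
    assert (H3 : (Cmod (F zeta) ^ n) ^ 2 <= (m ^ n) ^ 2).
    { apply pow_incr. split; [apply pow_le, Cmod_ge_0|].
      apply pow_incr. split; [apply Cmod_ge_0|assumption]. }
    assert (2 * (Cmod (F zeta) ^ n) ^ 2 / Cmod (zeta - z0) ^ 2 <= 2 * (m ^ n) ^ 2 / d ^ 2).
    { unfold Rdiv. apply Rmult_le_compat.
      - generalize (pow2_ge_0 (Cmod (F zeta) ^ n)). lra.
      - left. apply Rinv_0_lt_compat; assumption.
      - lra.
      - apply Rinv_le_contravar; assumption. }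
    lra.
Qed.

(** * Curves in preimages of discs *)

(** Around [z1] there is a disc on which [|g - g z1| < eta]; Phragmen-Lindelof on its exterior,
    where [g - g z1] is bounded, spreads the bound [eta] to the whole plane. *)
Lemma liouville (g : C -> C) (b : C) (R0 : R) :
  (forall z, cdiff g z) -> (forall z, Cmod (g z - b) <= R0) -> forall p q, g p = g q.
Proof.
  intros Dg Hb p z1.
  cut (Cmod (g p - g z1) <= 0).
  { intros H. assert (H0 := Cmod_ge_0 (g p - g z1)).
    replace (g p) with ((g p - g z1) + g z1)%C by ring.
    rewrite (Cmod_eq_0 (g p - g z1)) by lra. ring. }
  apply le_epsilon. intros eta Heta. rewrite Rplus_0_l.
  destruct (proj1 (ccont_eps _ _) (cdiff_ccont _ _ (Dg z1)) eta Heta) as [r [Hr Hr2]].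
  destruct (Rlt_dec (r / 2) (Cmod (p - z1))) as [K|K]; [|left; apply Hr2; lra].
  apply (phragmen_lindelof (fun z => r / 2 < Cmod (z - z1)) (fun z => g z - g z1)%C z1 (r / 2) eta
           (2 * R0)); try lra.
  - intros z Hz. exists ((Cmod (z - z1) - r / 2) / 2). split; [lra|]. intros w Hw.
    replace (z - z1)%C with ((w - z1) + - (w - z))%C in * by ring.
    assert (T := Cmod_triangle (w - z1) (- (w - z))). rewrite Cmod_opp in T. lra.
  - intros z Hz. split; [|split; [lra|]].
    + apply cdiff_minus; [apply Dg|apply cdiff_const].
    + replace (g z - g z1)%C with ((g z - b) + - (g z1 - b))%C by ring.
      eapply Rle_trans; [apply Cmod_triangle|]. rewrite Cmod_opp.
      assert (B1 := Hb z). assert (B2 := Hb z1). lra.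
  - intros z _ Hz. split.
    + apply (cdiff_ccont (fun z => g z - g z1)%C). apply cdiff_minus; [apply Dg|apply cdiff_const].
    + left. apply Hr2. lra.
Qed.

Notation path_continuous s t := (@continuous R_UniformSpace C_UniformSpace s t).

(** Continuity is demanded on all of [R], although only the times in [0, 1] are confined to [G];
    this avoids one-sided continuity when paths are joined. *)
Definition path_in (G : C -> Prop) (p z : C) : Prop :=
  exists s : R -> C, (forall t, path_continuous s t) /\ s 0 = p /\ s 1 = z /\
    forall t, 0 <= t <= 1 -> G (s t).

Definition clamp (t : R) : R := Rmax 0 (Rmin 1 t).

Lemma clamp_le0 t : t <= 0 -> clamp t = 0.
Proof. intros H. unfold clamp. rewrite Rmin_right by lra. apply Rmax_left. lra. Qed.

Lemma clamp_ge1 t : 1 <= t -> clamp t = 1.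
Proof. intros H. unfold clamp. rewrite Rmin_left by lra. apply Rmax_right. lra. Qed.

Lemma clamp_id t : 0 <= t <= 1 -> clamp t = t.
Proof. intros H. unfold clamp. rewrite Rmin_right by lra. apply Rmax_right. lra. Qed.

Lemma continuous_clamp t : continuous clamp t.
Proof.
  apply filterlim_locally. intros e. exists e. intros s Hs.
  change (Rabs (s - t) < e) in Hs. change (Rabs (clamp s - clamp t) < e).
  apply Rle_lt_trans with (2 := Hs). clear Hs.
  assert (H : forall x, x <= 0 /\ clamp x = 0 \/ 0 <= x <= 1 /\ clamp x = x \/ 1 <= x /\ clamp x = 1).
  { intros x. destruct (Rle_dec x 0); [left; split; [|apply clamp_le0]; lra|right].
    destruct (Rle_dec x 1); [left; split; [|apply clamp_id]; lra|right].
    split; [|apply clamp_ge1]; lra. }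
  destruct (H s) as [[? ->]|[[? ->]|[? ->]]], (H t) as [[? ->]|[[? ->]|[? ->]]];
    unfold Rabs; repeat destruct Rcase_abs; lra.
Qed.

Lemma continuous_clamped (s : R -> C) (a b t : R) :
  (forall t, path_continuous s t) -> path_continuous (fun t => s (clamp (a * t - b))) t.
Proof.
  intros Hs. apply (continuous_comp (fun t => clamp (a * t - b)) s); [|apply Hs].
  apply (continuous_comp (fun t => a * t - b) clamp); [|apply continuous_clamp].
  apply (continuous_minus (V := R_NormedModule)); [|apply continuous_const].
  apply (continuous_mult (K := R_AbsRing)); [apply continuous_const|apply continuous_id].
Qed.

Lemma path_in_mono (G G' : C -> Prop) p z :
  (forall w, G w -> G' w) -> path_in G p z -> path_in G' p z.
Proof. intros H (s & H1 & H2 & H3 & H4). exists s. split; [|split; [|split]]; auto. Qed.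

(** The two paths are added rather than glued by cases: while one clamped path moves the other is
    constant, so continuity is that of a sum. *)
Lemma path_in_trans G p q z : path_in G p q -> path_in G q z -> path_in G p z.
Proof.
  intros (s & S1 & S2 & S3 & S4) (u & U1 & U2 & U3 & U4).
  exists (fun t => s (clamp (2 * t - 0)) + (u (clamp (2 * t - 1)) - q))%C.
  split; [|split; [|split]].
  - intros t. apply continuous_Cplus; [apply continuous_clamped, S1|].
    apply continuous_Cminus; [apply continuous_clamped, U1|apply continuous_const].
  - rewrite !clamp_le0 by lra. rewrite S2, U2. ring.
  - rewrite !clamp_ge1 by lra. rewrite S3, U3. ring.
  - intros t Ht. destruct (Rle_dec t (1 / 2)) as [K|K].
    + rewrite (clamp_le0 (2 * t - 1)), U2 by lra.
      replace (s (clamp (2 * t - 0)) + (q - q))%C with (s (clamp (2 * t - 0))) by ring.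
      apply S4. rewrite clamp_id; lra.
    + rewrite (clamp_ge1 (2 * t - 0)), S3 by lra.
      replace (q + (u (clamp (2 * t - 1)) - q))%C with (u (clamp (2 * t - 1))) by ring.
      apply U4. rewrite clamp_id; lra.
Qed.

Lemma path_in_segment (G : C -> Prop) p z r :
  (forall w, Cmod (w - p) <= r -> G w) -> Cmod (z - p) <= r -> path_in G p z.
Proof.
  intros HG Hz. exists (fun t => p + RtoC t * (z - p))%C. split; [|split; [|split]].
  - intros t. apply continuous_Cplus; [apply continuous_const|].
    apply continuous_Cmult; [|apply continuous_const].
    apply continuous_C_pair; [apply continuous_id|apply continuous_const].
  - ring.
  - ring.
  - intros t Ht. apply HG. replace (p + RtoC t * (z - p) - p)%C with (RtoC t * (z - p))%C by ring.
    rewrite Cmod_mult, Cmod_R, Rabs_pos_eq by lra.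
    assert (H0 := Cmod_ge_0 (z - p)). nra.
Qed.

Lemma path_in_sym (G : C -> Prop) p z : path_in G p z -> path_in G z p.
Proof.
  intros (s & S1 & S2 & S3 & S4). exists (fun t => s (1 - t)). split; [|split; [|split]].
  - intros t. apply (continuous_comp (fun t => 1 - t) s); [|apply S1].
    apply (continuous_minus (V := R_NormedModule)); [apply continuous_const|apply continuous_id].
  - rewrite Rminus_0_r. assumption.
  - replace (1 - 1) with 0 by ring. assumption.
  - intros t Ht. apply S4. lra.
Qed.

Definition entire_nonconstant (g : C -> C) : Prop :=
  (forall z, cdiff g z) /\ exists p q, g p <> g q.

(* If [g] stays away from [b] on the path component [U] of [p] in [|g - b| < R0], then
   [1 / (g - b)] is bounded on [U] and has modulus [1 / R0] on its boundary, which
   Phragmen-Lindelof forbids. *)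
Lemma path_towards_center (g : C -> C) (p b : C) (R0 s : R) :
  entire_nonconstant g -> Cmod (g p - b) < R0 -> 0 < s ->
  exists z, path_in (fun w => Cmod (g w - b) < R0) p z /\ Cmod (g z - b) < s.
Proof.
  intros [Dg (p1 & p2 & Hnc)] Hp Hs. apply NNPP. intros N.
  set (G := fun w => Cmod (g w - b) < R0) in *.
  set (U := path_in G p).
  assert (HR : 0 < R0) by (generalize (Cmod_ge_0 (g p - b)); lra).
  assert (Up : U p).
  { apply path_in_segment with 0.
    - intros w Hw. replace w with p; [exact Hp|].
      replace w with ((w - p) + p)%C by ring. rewrite (Cmod_eq_0 (w - p)); [ring|].
      generalize (Cmod_ge_0 (w - p)). lra.
    - replace (p - p)%C with (RtoC 0) by ring. rewrite Cmod_0. lra. }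
  assert (Us : forall z, U z -> s <= Cmod (g z - b)).
  { intros z Hz. apply Rnot_lt_le. intros K. apply N. exists z. split; assumption. }
  assert (UG : forall z, U z -> G z).
  { intros z (u & _ & _ & <- & Hu). apply Hu. lra. }
  assert (Gop : forall z, G z -> exists r, 0 < r /\ forall w, Cmod (w - z) <= r -> G w).
  { intros z Hz. unfold G in Hz.
    destruct (proj1 (ccont_eps _ _) (cdiff_ccont _ _ (Dg z)) (R0 - Cmod (g z - b))) as [r [Hr H]];
      [lra|].
    exists (r / 2). split; [lra|]. intros w Hw. specialize (H w ltac:(lra)). unfold G.
    replace (g w - b)%C with ((g w - g z) + (g z - b))%C by ring.
    assert (T := Cmod_triangle (g w - g z) (g z - b)). lra. }
  (* A point [z0] where [g] leaves the closed disc of radius [R0]; by continuity a whole disc about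
     [z0] avoids [U], as Phragmen-Lindelof requires. *)
  destruct (not_all_ex_not _ _ (fun K => Hnc (liouville g b R0 Dg K p1 p2))) as [z0 Hz0].
  apply Rnot_le_lt in Hz0.
  destruct (proj1 (ccont_eps _ _) (cdiff_ccont _ _ (Dg z0)) (Cmod (g z0 - b) - R0)) as [d [Hd Hd2]];
    [lra|].
  assert (Inv : forall z e, 0 < e -> e <= Cmod (g z - b) ->
    (g z - b)%C <> RtoC 0 /\ Cmod (/ (g z - b)) <= / e).
  { intros z e He H. assert (Hne : (g z - b)%C <> RtoC 0) by (apply Cmod_gt_0; lra).
    split; [assumption|]. rewrite Cmod_inv by assumption. apply Rinv_le_contravar; assumption. }
  assert (Dm : forall z, cdiff (fun w => g w - b)%C z).
  { intros z. apply cdiff_minus; [apply Dg|apply cdiff_const]. }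
  assert (PL : Cmod (/ (g p - b)) <= / R0).
  { apply (phragmen_lindelof U (fun z => / (g z - b))%C z0 d (/ R0) (/ s)); try assumption.
    - apply Rinv_0_lt_compat; assumption.
    - intros z Hz. destruct (Gop z (UG z Hz)) as [r [Hr Hball]]. exists r. split; [assumption|].
      intros w Hw. apply path_in_trans with z; [assumption|].
      apply path_in_segment with r; assumption.
    - intros z Hz. destruct (Inv z s Hs (Us z Hz)) as [Hne Hi]. split; [|split; [|assumption]].
      + apply (cdiff_inv (fun w => g w - b)%C); [apply Dm|assumption].
      + apply Rnot_lt_le. intros K. specialize (Hd2 z K). assert (HG := UG z Hz). unfold G in HG.
        assert (T := Cmod_triangle (g z - b) (- (g z - g z0))). rewrite Cmod_opp in T.
        replace (g z - b + - (g z - g z0))%C with (g z0 - b)%C in T by ring. lra.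
    (* A limit point of [U] with [|g - b| < R0] would be joined to [U] by a segment inside [G] and
       so belong to [U]; hence [|g - b| >= R0] at the limit points outside [U]. *)
    - intros z Hcl Hz.
      assert (HRz : R0 <= Cmod (g z - b)).
      { apply Rnot_lt_le. intros K. destruct (Gop z K) as [r [Hr Hball]].
        destruct (Hcl r Hr) as [w [Hw Hwz]]. apply Hz. apply path_in_trans with w; [assumption|].
        apply path_in_sym, path_in_segment with r; [assumption|lra]. }
      destruct (Inv z R0 HR HRz) as [Hne Hi]. split; [|assumption].
      apply (cdiff_ccont (fun w => / (g w - b))%C).
      apply (cdiff_inv (fun w => g w - b)%C); [apply Dm|assumption]. }
  destruct (Inv p s Hs (Us p Up)) as [Hne _]. rewrite Cmod_inv in PL by assumption.
  assert (H0 := proj1 (Cmod_gt_0 _) Hne).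
  assert (/ R0 < / Cmod (g p - b)); [|lra].
  apply Rinv_lt_contravar; [apply Rmult_lt_0_compat|]; assumption.
Qed.

(** The local equivalence says that [T] is both open and closed in the interval, so the supremum of
    the times where [T] holds must be [b]. *)
Lemma interval_connected (T : R -> Prop) (a b : R) :
  a <= b -> T a ->
  (forall t, a <= t <= b -> exists d, 0 < d /\
     forall t', a <= t' <= b -> Rabs (t' - t) < d -> (T t' <-> T t)) ->
  T b.
Proof.
  intros Hab Ha Hloc.
  destruct (completeness (fun t => a <= t <= b /\ T t)) as [m [Hm1 Hm2]].
  - exists b. intros t [Ht _]. lra.
  - exists a. split; [lra|assumption].
  - assert (Hma : a <= m) by (apply Hm1; split; [lra|assumption]).
    assert (Hmb : m <= b) by (apply Hm2; intros t [Ht _]; lra).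
    destruct (Hloc m (conj Hma Hmb)) as [d [Hd H]].
    assert (Tm : T m).
    { apply NNPP. intros K. assert (m <= m - d / 2); [|lra].
      apply Hm2. intros t [Ht HT]. apply Rnot_lt_le. intros K2. apply K.
      assert (t <= m) by (apply Hm1; tauto).
      apply (H t Ht); [|assumption]. apply Rabs_def1; lra. }
    destruct (Rle_lt_dec b m) as [K|K]; [replace b with m by lra; assumption|].
    assert (Hmin := Rmin_l (m + d / 2) b). assert (Hmin2 := Rmin_r (m + d / 2) b).
    assert (Hlt : m < Rmin (m + d / 2) b) by (apply Rmin_glb_lt; lra).
    assert (Rmin (m + d / 2) b <= m); [|lra].
    apply Hm1. split; [lra|]. apply H; [lra| |assumption]. apply Rabs_def1; lra.
Qed.

Lemma halfline_eps (gamma : R -> C) (t e : R) :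
  cont_on_halfline gamma -> 0 <= t -> 0 < e ->
  exists d, 0 < d /\ forall t', 0 <= t' -> Rabs (t' - t) < d -> Cmod (gamma t' - gamma t) < e.
Proof.
  intros H Ht He. specialize (H t Ht).
  rewrite filterlim_C in H by (apply within_filter, locally_filter).
  destruct (H e He) as [d Hd]. exists d. split; [apply cond_pos|].
  intros t' Ht' Hd'. apply Hd; assumption.
Qed.

(** Coming arbitrarily close to [gamma t] with [g], along paths that stay in the preimage of [V], is
    a locally constant property of [t]: a point close to [gamma t'] already lies in a disc about
    [gamma t] contained in [V], and within the preimage of that disc one can move towards the
    centre. *)
Lemma follow_curve (g : C -> C) (gamma : R -> C) (V : C -> Prop) (p : C) (a b r s : R) :
  entire_nonconstant g -> cont_on_halfline gamma -> 0 <= a <= b ->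
  (forall t, a <= t <= b -> exists r, 0 < r /\ forall w, Cmod (w - gamma t) < r -> V w) ->
  (forall w, Cmod (w - gamma a) < r -> V w) -> Cmod (g p - gamma a) < r -> 0 < s ->
  exists z, path_in (fun w => V (g w)) p z /\ Cmod (g z - gamma b) < s.
Proof.
  intros Hg Hgam Hab HV Hr Hp. revert s.
  set (T := fun t => forall s, 0 < s ->
    exists z, path_in (fun w => V (g w)) p z /\ Cmod (g z - gamma t) < s).
  change (T b). apply (interval_connected T a b); [lra| |].
  - intros s Hs. destruct (path_towards_center g p (gamma a) r s Hg Hp Hs) as (z & Hz & Hz2).
    exists z. split; [|assumption]. revert Hz. apply path_in_mono. intros w. apply Hr.
  - clear r Hr Hp. intros t Ht. destruct (HV t Ht) as [r [Hr HVr]].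
    (* With this margin the disc of radius [r / 2] about [gamma t'] still lies in the disc of radius
       [r] about [gamma t], and the starting point fits in whichever disc is used. *)
    destruct (halfline_eps gamma t (r / 4) Hgam) as [d [Hd Hd2]]; [lra|lra|].
    exists d. split; [assumption|]. intros t' Ht' Htt. specialize (Hd2 t' ltac:(lra) Htt).
    split; intros HT s Hs.
    + destruct (HT (r / 2)) as (z & Hz & Hz2); [lra|].
      destruct (path_towards_center g z (gamma t) r s Hg) as (z' & Hz' & Hz2'); [|assumption|].
      * replace (g z - gamma t)%C with ((g z - gamma t') + (gamma t' - gamma t))%C by ring.
        eapply Rle_lt_trans; [apply Cmod_triangle|]. lra.
      * exists z'. split; [|assumption]. apply path_in_trans with z; [assumption|].
        revert Hz'. apply path_in_mono. intros w. apply HVr.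
    + destruct (HT (r / 4)) as (z & Hz & Hz2); [lra|].
      destruct (path_towards_center g z (gamma t') (r / 2) s Hg) as (z' & Hz' & Hz2');
        [|assumption|].
      * replace (g z - gamma t')%C with ((g z - gamma t) + - (gamma t' - gamma t))%C by ring.
        eapply Rle_lt_trans; [apply Cmod_triangle|]. rewrite Cmod_opp. lra.
      * exists z'. split; [|assumption]. apply path_in_trans with z; [assumption|].
        revert Hz'. apply path_in_mono. intros w Hw. apply HVr.
        replace (g w - gamma t)%C with ((g w - gamma t') + (gamma t' - gamma t))%C by ring.
        eapply Rle_lt_trans; [apply Cmod_triangle|]. lra.
Qed.

Lemma concatenate_paths (p : nat -> C) (V : nat -> C -> Prop) :
  (forall k, path_in (V k) (p k) (p (S k))) ->
  exists s : R -> C, (forall t, path_continuous s t) /\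
    forall k t, INR k <= t <= INR k + 1 -> V k (s t).
Proof.
  intros H.
  destruct (choice (fun k (s : R -> C) => (forall t, path_continuous s t) /\ s 0 = p k /\
    s 1 = p (S k) /\ forall t, 0 <= t <= 1 -> V k (s t)) H) as [u Hu].
  (* A telescoping sum of clamped increments: the summand with index [k] varies only for [t] in
     [k, k + 1], so [D n t] no longer depends on [n] once [t <= INR n]. *)
  set (D := fix D n t := match n with O => p 0%nat
    | S k => (D k t + (u k (clamp (1 * t - INR k)) - p k))%C end).
  assert (Dcont : forall n t, path_continuous (D n) t).
  { induction n as [|n IH]; intros t; simpl; [apply continuous_const|].
    apply continuous_Cplus; [apply IH|].
    apply continuous_Cminus; [apply continuous_clamped, Hu|apply continuous_const]. }
  assert (Dend : forall n t, INR n <= t -> D n t = p n).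
  { induction n as [|n IH]; intros t Ht; [reflexivity|]. rewrite S_INR in Ht. simpl D.
    rewrite IH by lra. rewrite clamp_ge1 by lra. destruct (Hu n) as (_ & _ & -> & _). ring. }
  assert (Dstab : forall k n t, t <= INR n -> D (k + n)%nat t = D n t).
  { induction k as [|k IH]; intros n t Ht; [reflexivity|]. simpl D.
    rewrite IH by assumption. rewrite clamp_le0.
    - destruct (Hu (k + n)%nat) as (_ & -> & _). ring.
    - rewrite plus_INR. generalize (pos_INR k). lra. }
  assert (Dval : forall k t, INR k <= t <= INR k + 1 -> D (S k) t = u k (t - INR k)).
  { intros k t Ht. simpl D. rewrite Dend by lra.
    rewrite clamp_id by lra. rewrite Rmult_1_l. ring. }
  set (n := fun t => Z.to_nat (up t)).
  assert (Hn : forall t, t <= INR (n t)).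
  { intros t. unfold n. destruct (archimed t) as [A1 _].
    destruct (Z.le_gt_cases 0 (up t)) as [K|K].
    - rewrite INR_IZR_INZ, Z2Nat.id by assumption. lra.
    - apply IZR_lt in K. generalize (pos_INR (Z.to_nat (up t))). lra. }
  assert (Dn : forall t m, t <= INR m -> D (n t) t = D m t).
  { intros t m Hm. rewrite <- (Dstab m (n t) t) by apply Hn. rewrite Nat.add_comm.
    apply Dstab, Hm. }
  exists (fun t => D (n t) t). split.
  (* The index [n t] jumps at integers; taking it at [t + 1] gives a single partial sum valid on a
     neighbourhood of [t]. *)
  - intros t. apply continuous_ext_loc with (D (n (t + 1))); [|apply Dcont].
    exists (mkposreal 1 Rlt_0_1). intros s Hs. change (Rabs (s - t) < 1) in Hs.
    symmetry. apply Dn. apply Rabs_def2 in Hs. specialize (Hn (t + 1)). lra.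
  - intros k t Ht. rewrite (Dn t (S k)) by (rewrite S_INR; lra). rewrite Dval by assumption.
    apply Hu. lra.
Qed.

(** * Curves tending to infinity and asymptotic values of compositions *)

Lemma escapes_or_clusters (s : R -> C) :
  filterlim (fun t => Cmod (s t)) (Rbar_locally p_infty) (Rbar_locally p_infty) \/
  exists zeta, forall e T, 0 < e -> exists t, T < t /\ Cmod (s t - zeta) < e.
Proof.
  destruct (classic (exists L, forall T, exists t, T < t /\ Cmod (s t) <= L)) as [[L HL]|N].
  - right.
    (* Bolzano-Weierstrass for the tails of the curve, with [/ e] as starting time so that small [e]
       means late; [0 < e] is recorded because the inverse is decreasing only there. *)
    destruct (bounded_cluster_point (fun e z => exists t, / e < t /\ 0 < e /\ z = s t) L)
      as [zeta Hz].
    + intros e e' z He (t & Ht & Hp & ->). exists t. split; [|split; [lra|reflexivity]].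
      apply Rle_lt_trans with (2 := Ht). apply Rinv_le_contravar; assumption.
    + intros e He. destruct (HL (/ e)) as (t & Ht & Hs). exists (s t). split; [|assumption].
      exists t. tauto.
    + exists zeta. intros e T He.
      set (e' := Rmin e (/ (Rabs T + 1))).
      assert (HT := Rabs_pos T). assert (HT2 := Rle_abs T).
      assert (He' : 0 < e') by (apply Rmin_glb_lt; [|apply Rinv_0_lt_compat]; lra).
      destruct (Hz e' He') as (z & (t & Ht & _ & ->) & Hd). exists t. split.
      * apply Rle_lt_trans with (2 := Ht). apply Rle_trans with (Rabs T + 1); [lra|].
        rewrite <- (Rinv_inv (Rabs T + 1)). apply Rinv_le_contravar; [assumption|apply Rmin_r].
      * apply Rlt_le_trans with (1 := Hd), Rmin_l.
  - left. intros P [L HP].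
    destruct (not_all_ex_not _ _ (fun K => N (ex_intro _ L K))) as [T HT].
    exists T. intros t Ht. apply HP. apply Rnot_le_lt. intros K. apply HT. exists t. split; assumption.
Qed.

Lemma cont_on_halfline_comp (g : C -> C) (gamma : R -> C) :
  (forall z, ccont g z) -> cont_on_halfline gamma -> cont_on_halfline (fun t => g (gamma t)).
Proof.
  intros Hg H t Ht. exact (filterlim_comp _ _ _ gamma g _ _ _ (H t Ht) (Hg (gamma t))).
Qed.

Lemma eventually_C (s : R -> C) (l : C) :
  filterlim s (Rbar_locally p_infty) (locally (T := C_UniformSpace) l) <->
  forall e, 0 < e -> exists T, forall t, T < t -> Cmod (s t - l) < e.
Proof. apply filterlim_C. apply Rbar_locally_filter. Qed.

Lemma elh_cdiff f : elh f -> forall z, cdiff f z.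
Proof.
  intros [H _] z. destruct (H z) as (l & Hl & _).
  destruct (has_cderiv_caratheodory f z l Hl) as (phi & H1 & _ & H2). exists phi. tauto.
Qed.

Lemma elh_nonconstant f : elh f -> entire_nonconstant f.
Proof.
  intros H. split; [apply elh_cdiff, H|]. apply NNPP. intros N. destruct H as [_ H].
  destruct (has_cderiv_caratheodory _ _ _ H) as (phi & H1 & H2 & H3).
  destruct (proj1 (ccont_eps _ _) H1 1 Rlt_0_1) as [d [Hd Hd2]].
  assert (Hm : Cmod (RtoC (d / 2)) = d / 2) by (rewrite Cmod_R; apply Rabs_pos_eq; lra).
  assert (E0 : (RtoC (d / 2) - 0)%C = RtoC (d / 2)) by ring.
  assert (Hne : RtoC (d / 2) <> RtoC 0) by (apply Cmod_gt_0; lra).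
  specialize (Hd2 (RtoC (d / 2))). rewrite H2, E0, Hm in Hd2. specialize (Hd2 ltac:(lra)).
  specialize (H3 (RtoC (d / 2))). rewrite E0 in H3.
  apply N. exists (RtoC (d / 2)), (RtoC 0). intros E. rewrite E in H3.
  assert (E2 : (phi (RtoC (d / 2)) * RtoC (d / 2))%C = RtoC 0).
  { replace (phi (RtoC (d / 2)) * RtoC (d / 2))%C
      with ((f 0 + phi (RtoC (d / 2)) * RtoC (d / 2)) - f 0)%C by ring.
    rewrite <- H3. ring. }
  assert (E3 : phi (RtoC (d / 2)) = RtoC 0).
  { apply NNPP. intros K. exact (Cmult_neq_0 _ _ K Hne E2). }
  rewrite E3 in Hd2. replace (0 - 1)%C with (- RtoC 1)%C in Hd2 by ring.
  rewrite Cmod_m1 in Hd2. lra.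
Qed.

Lemma asymptotic_variety_comp_outer (f g : C -> C) (alpha : C) :
  (forall z, ccont f z) -> entire_nonconstant g ->
  asymptotic_variety f alpha -> asymptotic_variety (fun z => f (g z)) alpha.
Proof.
  intros Cf Hg (gamma & Hc & Hinf & Hlim).
  assert (Cg : forall z, ccont g z) by (intros z; apply cdiff_ccont, Hg).
  (* A neighbourhood of the tail of [gamma] from time [k] on, in which two things are controlled:
     distance 1 in the plane will drive the new curve to infinity, and the tolerance [/ INR (S k)]
     on [f] will preserve the limit. *)
  set (V := fun k w => exists t, INR k <= t /\ Cmod (w - gamma t) < 1 /\
                       Cmod (f w - f (gamma t)) < / INR (S k)).
  assert (Hk : forall k, 0 < / INR (S k)).
  { intros k. apply Rinv_0_lt_compat. rewrite S_INR. generalize (pos_INR k). lra. }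
  assert (HV : forall k t, INR k <= t ->
    exists r, 0 < r /\ forall w, Cmod (w - gamma t) < r -> V k w).
  { intros k t Ht. destruct (proj1 (ccont_eps _ _) (Cf (gamma t)) _ (Hk k)) as [d [Hd H]].
    exists (Rmin d 1). split; [apply Rmin_glb_lt; lra|]. intros w Hw. exists t.
    assert (M1 := Rmin_l d 1). assert (M2 := Rmin_r d 1).
    split; [assumption|]. split; [lra|]. apply H. lra. }
  (* The point [p] has its image in a disc about [gamma k] contained in [V k], which is the starting
     condition of [follow_curve]. *)
  set (Q := fun k p => exists r, (forall w, Cmod (w - gamma (INR k)) < r -> V k w) /\
                        Cmod (g p - gamma (INR k)) < r).
  assert (Q0 : exists p, Q 0%nat p).
  { destruct (HV 0%nat (INR 0) (Rle_refl _)) as [r [Hr H]].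
    (* Only the end point matters here: the disc is just large enough to contain [g 0], and the path
       is discarded. *)
    destruct (path_towards_center g 0 (gamma (INR 0)) (Cmod (g 0%C - gamma (INR 0)) + 1) r Hg)
      as (z & _ & Hz); [lra|assumption|].
    exists z, r. tauto. }
  destruct Q0 as [p0 Q0].
  destruct (dependent_choice_seq Q (fun k => path_in (fun w => V k (g w))) p0 Q0) as (p & _ & Hp).
  { intros k z (r & Hr & Hz).
    destruct (HV (S k) (INR (S k)) (Rle_refl _)) as [r' [Hr' H']].
    assert (H0 := pos_INR k).
    destruct (follow_curve g gamma (V k) z (INR k) (INR (S k)) r r' Hg Hc) as (z' & Hz' & Hz2);
      try assumption.
    - rewrite S_INR. lra.
    - intros t Ht. apply HV. lra.
    - exists z'. split; [|assumption]. exists r'. tauto. }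
  destruct (concatenate_paths p (fun k w => V k (g w)) (fun k => proj2 (Hp k))) as (s & Hs & HsV).
  assert (Near : forall T, exists T', forall t, T' < t -> exists t' k,
    T < t' /\ T < INR k /\ Cmod (g (s t) - gamma t') < 1 /\
    Cmod (f (g (s t)) - f (gamma t')) < / INR (S k)).
  { intros T. exists (Rabs T + 1). intros t Ht.
    assert (HT := Rle_abs T). assert (HT' := Rabs_pos T).
    destruct (nfloor_ex t) as [k Hkt]; [lra|].
    destruct (HsV k t) as (t' & H1 & H2 & H3); [lra|].
    exists t', k. repeat split; try assumption; lra. }
  exists s. split; [|split].
  - intros t _. apply filterlim_filter_le_1 with (2 := Hs t). apply filter_le_within.
  (* Near a cluster point [zeta] the value [g (s t)] is within 1 of [g zeta], which places
     [gamma t'] within 2 of [g zeta] for a late [t'], against [Hinf]. *)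
  - destruct (escapes_or_clusters s) as [E|[zeta Hz]]; [exact E|exfalso].
    destruct (proj1 (ccont_eps _ _) (Cg zeta) 1 Rlt_0_1) as [d [Hd Hd2]].
    destruct (Hinf (fun x => Cmod (g zeta) + 2 < x)) as [T HT].
    { exists (Cmod (g zeta) + 2). tauto. }
    destruct (Near T) as [T' HT']. destruct (Hz d T' Hd) as (t & Ht & Hst).
    destruct (HT' t Ht) as (t' & k & H1 & _ & H2 & _).
    specialize (HT t' H1). specialize (Hd2 _ Hst).
    assert (T1 := Cmod_triangle (g zeta) ((g (s t) - g zeta) + - (g (s t) - gamma t'))).
    assert (T2 := Cmod_triangle (g (s t) - g zeta) (- (g (s t) - gamma t'))).
    rewrite Cmod_opp in T2.
    replace (g zeta + (g (s t) - g zeta + - (g (s t) - gamma t')))%C with (gamma t') in T1 by ring.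
    lra.
  - apply eventually_C. intros e He.
    destruct (proj1 (eventually_C _ _) Hlim (e / 2)) as [T HT]; [lra|].
    destruct (Near (Rmax T (2 / e))) as [T' HT']. exists T'. intros t Ht.
    destruct (HT' t Ht) as (t' & k & H1 & H1' & _ & H2).
    assert (M1 := Rmax_l T (2 / e)). assert (M2 := Rmax_r T (2 / e)).
    specialize (HT t' ltac:(lra)).
    assert (H3 : / INR (S k) < e / 2).
    { replace (e / 2) with (/ (2 / e)) by (field; lra).
      assert (0 < 2 / e) by (apply Rdiv_lt_0_compat; lra).
      apply Rinv_lt_contravar; rewrite S_INR; [apply Rmult_lt_0_compat|]; lra. }
    replace (f (g (s t)) - alpha)%C
      with ((f (g (s t)) - f (gamma t')) + (f (gamma t') - alpha))%C by ring.
    eapply Rle_lt_trans; [apply Cmod_triangle|]. lra.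
Qed.

(* Near a solution [zeta] of [f zeta = alpha] one has [|f w - alpha| >= c |w - zeta|], so a curve
   along which [f] tends to [alpha] cannot cross small circles around [zeta] late in time. *)
Lemma asymptotic_cluster_point_is_limit (f : C -> C) (w : R -> C) (zeta alpha l : C) :
  has_cderiv f zeta l -> l <> RtoC 0 -> cont_on_halfline w ->
  filterlim (fun t => f (w t)) (Rbar_locally p_infty) (locally (T := C_UniformSpace) alpha) ->
  (forall e T, 0 < e -> exists t, T < t /\ Cmod (w t - zeta) < e) ->
  f zeta = alpha /\ filterlim w (Rbar_locally p_infty) (locally (T := C_UniformSpace) zeta).
Proof.
  intros Hl Hl0 Hw Hlim Hcl. rewrite eventually_C in Hlim.
  destruct (has_cderiv_caratheodory f zeta l Hl) as (phi & P1 & P2 & P3).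
  assert (Cf : ccont f zeta) by (apply cdiff_ccont; exists phi; tauto).
  assert (E : f zeta = alpha).
  { apply NNPP. intros N.
    assert (N' : (f zeta - alpha)%C <> RtoC 0).
    { intros K. apply N. replace (f zeta) with ((f zeta - alpha) + alpha)%C by ring. rewrite K. ring. }
    apply Cmod_gt_0 in N'. set (e := Cmod (f zeta - alpha)) in *.
    destruct (Hlim (e / 2)) as [T HT]; [lra|].
    destruct (proj1 (ccont_eps _ _) Cf (e / 2)) as [d [Hd Hd2]]; [lra|].
    destruct (Hcl d T Hd) as (t & Ht & Htd). specialize (HT t Ht). specialize (Hd2 _ Htd).
    assert (Tr := Cmod_triangle (f (w t) - alpha) (- (f (w t) - f zeta))). rewrite Cmod_opp in Tr.
    replace (f (w t) - alpha + - (f (w t) - f zeta))%C with (f zeta - alpha)%C in Tr by ring.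
    fold e in Tr. lra. }
  split; [assumption|]. apply eventually_C. intros e0 He0.
  apply Cmod_gt_0 in Hl0. set (c := Cmod l) in *.
  destruct (proj1 (ccont_eps _ _) P1 (c / 2)) as [d [Hd Hd2]]; [lra|].
  set (e := Rmin e0 (d / 2)).
  assert (He : 0 < e) by (apply Rmin_glb_lt; lra).
  assert (Hee : e <= e0) by apply Rmin_l. assert (Hed : e <= d / 2) by apply Rmin_r.
  assert (Hce : 0 < c / 2 * e) by (apply Rmult_lt_0_compat; lra).
  destruct (Hlim (c / 2 * e) Hce) as [T HT].
  assert (Hcross : forall t, T < t -> Cmod (w t - zeta) <> e).
  { intros t Ht K. specialize (HT t Ht). specialize (Hd2 (w t) ltac:(lra)). rewrite P2 in Hd2.
    rewrite (P3 (w t)), E in HT.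
    replace (alpha + phi (w t) * (w t - zeta) - alpha)%C with (phi (w t) * (w t - zeta))%C in HT by ring.
    rewrite Cmod_mult, K in HT. apply Rmult_lt_reg_r in HT; [|assumption].
    assert (Tr := Cmod_triangle (phi (w t)) (- (phi (w t) - l))). rewrite Cmod_opp in Tr.
    replace (phi (w t) + - (phi (w t) - l))%C with l in Tr by ring. fold c in Tr. lra. }
  destruct (Hcl e (Rmax T 0) He) as (t1 & Ht1 & Hwt1).
  assert (M1 := Rmax_l T 0). assert (M2 := Rmax_r T 0).
  exists t1. intros t Ht. apply Rlt_le_trans with (2 := Hee).
  apply (interval_connected (fun t => Cmod (w t - zeta) < e) t1 t); [lra|assumption|].
  intros u Hu.
  (* The distance of [w u] to the circle, nonzero by [Hcross]: as long as [w] moves by less than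
     this, it stays on the same side. *)
  assert (Hgap : 0 < Rabs (Cmod (w u - zeta) - e)).
  { apply Rabs_pos_lt. specialize (Hcross u ltac:(lra)). lra. }
  destruct (halfline_eps w u _ Hw ltac:(lra) Hgap) as [r [Hr Hr2]].
  exists r. split; [assumption|]. intros u' Hu' Huu. specialize (Hr2 u' ltac:(lra) Huu).
  assert (T1 := Cmod_triangle (w u' - w u) (w u - zeta)).
  assert (T2 := Cmod_triangle (w u' - zeta) (- (w u' - w u))). rewrite Cmod_opp in T2.
  replace (w u' - w u + (w u - zeta))%C with (w u' - zeta)%C in T1 by ring.
  replace (w u' - zeta + - (w u' - w u))%C with (w u - zeta)%C in T2 by ring.
  unfold Rabs in Hr2. destruct (Rcase_abs (Cmod (w u - zeta) - e)); lra.
Qed.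

Theorem theorem3p8 (f g : C -> C) (hf : elh f) (hg : elh g) :
  forall alpha : C,
    asymptotic_variety (fun z => f (g z)) alpha <->
    (asymptotic_variety f alpha \/
     exists beta : C, asymptotic_variety g beta /\ f beta = alpha).
Proof.
  intros alpha.
  assert (Cf : forall z, ccont f z) by (intros z; apply cdiff_ccont, elh_cdiff, hf).
  assert (Cg : forall z, ccont g z) by (intros z; apply cdiff_ccont, elh_cdiff, hg).
  split.
  - intros (gamma & Hc & Hinf & Hlim).
    assert (Hw := cont_on_halfline_comp g gamma Cg Hc).
    destruct (escapes_or_clusters (fun t => g (gamma t))) as [E|[zeta Hz]].
    + left. exists (fun t => g (gamma t)). tauto.
    + right. destruct (proj1 hf zeta) as (l & Hl & Hl0).
      destruct (asymptotic_cluster_point_is_limit f _ zeta alpha l Hl Hl0 Hw Hlim Hz) as [H1 H2].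
      exists zeta. split; [|assumption]. exists gamma. tauto.
  - intros [H|(beta & (gamma & Hc & Hinf & Hlim) & <-)].
    + apply asymptotic_variety_comp_outer; [assumption|apply elh_nonconstant, hg|assumption].
    + exists gamma. split; [assumption|]. split; [assumption|].
      exact (filterlim_comp _ _ _ (fun t => g (gamma t)) f _ _ _ Hlim (Cf beta)).
Qed.
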